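(* Let $\mathbb{T}=(\mathbb{R}/\mathbb{Z})^{\mathbb{N}}$ and let $\mathcal{S}(\mathbb{T})$ be the space of closed subgroups of $\mathbb{T}$ with the Hausdorff metric. Then the set of $K\in\mathcal{S}(\mathbb{T})$ that are isomorphic as topological groups to $Z=\prod_{p\in\mathbf{P}}(Z_p)^{\mathbb{N}}$ is comeager in $\mathcal{S}(\mathbb{T})$.
   Context: $\mathbb{N}=\{1,2,3,\dots\}$. $\mathbb{R}/\mathbb{Z}$ is the circle group with its usual metric $d_{\mathbb{T}}$, and $\mathbb{T}$ carries the metric $d(x,y)=\sum_{n}2^{-n}d_{\mathbb{T}}(x(n),y(n))$. $\mathcal{S}(\mathbb{T})$ is the set of nonempty compact subgroups of $\mathbb{T}$ with the Hausdorff metric induced by $d$ (a compact metric space). $\mathbf{P}$ is the set of primes, $Z_p$ is the compact group of $p$-adic integers, and the products carry the product topology. Every compact metrizable abelian group is isomorphic to some element of $\mathcal{S}(\mathbb{T})$. *)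

(* Defs.v *)
From HB Require Import structures.
From mathcomp Require Import all_boot all_order all_algebra generic_quotient.
From mathcomp Require Import all_classical all_reals all_analysis.

Set Implicit Arguments.
Unset Strict Implicit.
Unset Printing Implicit Defensive.

Import Order.TTheory GRing.Theory Num.Theory.
Import numFieldNormedType.Exports.

Local Open Scope classical_set_scope.
Local Open Scope ring_scope.
Local Open Scope quotient_scope.

Section Category.
Context {X : topologicalType}.
Implicit Type A : set X.

Definition nowhere_dense A := (closure A)^° = set0.

Definition meager A :=
  exists2 F : (set X)^nat,
    (forall i, nowhere_dense (F i)) & A `<=` \bigcup_i F i.

Definition comeager A := meager (~` A).

End Category.

Definition topgroup_isomorphic (G H : topologicalZmodType) : Prop :=
  exists (f : {additive G -> H}) (g : {additive H -> G}),
    [/\ cancel f g, cancel g f, continuous f & continuous g].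

Lemma nonexpansive_continuous (R : realType) (M : metricType R)
    (s : M * M -> M) :
  (forall a b, mdist (s a) (s b) <= mdist a.1 b.1 + mdist a.2 b.2) ->
  continuous s.
Proof.
move=> sP [x y]; apply/metricType_numDomainType.cvgrPdist_lt => e e0.
have e20 : 0 < e / 2 by rewrite divr_gt0.
exists (ball x (e / 2), ball y (e / 2)).
  by split; exact: nbhsx_ballx.
move=> [x' y'] [/=]; rewrite !ballEmdist /= => xx' yy'.
by rewrite (le_lt_trans (sP _ _))//= [ltRHS]splitr ltrD.
Qed.

Section ProductGroup.
Context (I : Type) (T : I -> topologicalZmodType).

Let add (x y : prod_topology T) : prod_topology T := fun i => x i + y i.
Let opp (x : prod_topology T) : prod_topology T := fun i => - x i.
Let zero : prod_topology T := fun=> 0.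

Let addA : associative add.
Proof.
by move=> x y z; apply: functional_extensionality_dep => i; exact: addrA.
Qed.
Let addC : commutative add.
Proof.
by move=> x y; apply: functional_extensionality_dep => i; exact: addrC.
Qed.
Let add0 : left_id zero add.
Proof.
by move=> x; apply: functional_extensionality_dep => i; exact: add0r.
Qed.
Let addN : left_inverse zero opp add.
Proof.
by move=> x; apply: functional_extensionality_dep => i; exact: addNr.
Qed.

HB.instance Definition _ :=
  GRing.isZmodule.Build (prod_topology T) addA addC add0 addN.

Let eval_continuous i : continuous (fun f : prod_topology T => f i).
Proof.
move=> f; have /cvg_sup/(_ i) : f --> f by exact: cvg_id.
move=> h A nA; apply: h.
exact: (@initial_continuous _ _ (fun g : forall i, T i => g i) f A nA).
Qed.

Let sub_continuous :
  continuous (fun x : prod_topology T * prod_topology T => x.1 - x.2).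
Proof.
move=> x; apply/cvg_sup => i U [_ [[W oW <-]]] /= Wx /filterS; apply.
suff : {for x, continuous (fun x : prod_topology T * prod_topology T =>
    x.1 i - x.2 i)} by apply; exact: open_nbhs_nbhs.
apply: (@continuous_comp _ _ _
  (fun x : prod_topology T * prod_topology T => (x.1 i, x.2 i))
  (fun z : T i * T i => z.1 - z.2)); last exact: sub_continuous.
apply: cvg_pair.
  apply: (@continuous_comp _ _ _ fst (fun f : prod_topology T => f i)).
    exact: cvg_fst.
  exact: eval_continuous.
apply: (@continuous_comp _ _ _ snd (fun f : prod_topology T => f i)).
  exact: cvg_snd.
exact: eval_continuous.
Qed.

HB.instance Definition _ :=
  PreTopologicalNmodule_isTopologicalZmodule.Build (prod_topology T)
    sub_continuous.

End ProductGroup.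

Section DiscreteGroup.
Context (G : zmodType).

HB.instance Definition _ := GRing.Zmodule.copy (discrete_topology G) G.

Let sub_continuous :
  continuous (fun x : discrete_topology G * discrete_topology G => x.1 - x.2).
Proof.
move=> [x y] A /= /nbhs_singleton Axy; exists ([set x], [set y]).
  by split; exact: discrete_set1.
by move=> [x' y'] [/= -> ->].
Qed.

HB.instance Definition _ :=
  PreTopologicalNmodule_isTopologicalZmodule.Build (discrete_topology G)
    sub_continuous.

End DiscreteGroup.

Record subgroup (G : zmodType) := Subgroup {
  subgroup_set :> set G;
  subgroup_zmod_closed : zmod_closed (mem subgroup_set)
}.

Definition subgroup_type (G : zmodType) (K : subgroup G) : Type := set_type K.

Section SubgroupType.
Context (G : topologicalZmodType) (K : subgroup G).

HB.instance Definition _ := SubChoice.copy (subgroup_type K) (set_type K).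
HB.instance Definition _ := Topological.copy (subgroup_type K) (set_type K).
HB.instance Definition _ := GRing.SubChoice_isSubZmodule.Build
  G (mem (subgroup_set K)) (subgroup_type K) (subgroup_zmod_closed K).

Let sub_continuous :
  continuous (fun x : subgroup_type K * subgroup_type K => x.1 - x.2).
Proof.
apply: continuous_comp_initial; rewrite (_ : _ \o _ =
  (fun z : G * G => z.1 - z.2) \o
  (fun z : subgroup_type K * subgroup_type K => (\val z.1, \val z.2))); last first.
  by apply/funext => z; rewrite /= -[LHS]/(\val (z.1 - z.2)) raddfB.
move=> x; apply: continuous_comp; last exact: sub_continuous.
apply: cvg_pair.
  apply: (@continuous_comp _ _ _ fst (fun f : subgroup_type K => \val f)).
    exact: cvg_fst.
  exact: initial_continuous.
apply: (@continuous_comp _ _ _ snd (fun f : subgroup_type K => \val f)).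
  exact: cvg_snd.
exact: initial_continuous.
Qed.

HB.instance Definition _ :=
  PreTopologicalNmodule_isTopologicalZmodule.Build (subgroup_type K)
    sub_continuous.

End SubgroupType.

Section Circle.
Context (R : realType).

Definition integers : zmodClosed R :=
  GRing.ZmodClosed.clone R Num.int_num_subdef _.

Definition circle : Type := Quotient.quot integers.

HB.instance Definition _ := EqQuotient.on circle.
HB.instance Definition _ := GRing.Zmodule.on circle.

(* The distance from any representative of [c] to the nearest integer. *)
Definition circle_norm (c : circle) : R :=
  inf [set `|a| | a in [set a : R | \pi_circle a = c]].

Definition circle_dist (x y : circle) : R := circle_norm (x - y).

Lemma pi_circleD (a b : R) : \pi_circle (a + b) = \pi_circle a + \pi_circle b.
Proof. exact: Quotient.pi_add. Qed.

Lemma pi_circleN (a : R) : \pi_circle (- a) = - \pi_circle a.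
Proof. exact: Quotient.pi_opp. Qed.

Lemma pi_circle_eq (a b : R) :
  (\pi_circle a = \pi_circle b) <-> a - b \is a Num.int.
Proof.
split=> [/eqP|ab]; last apply/eqP.
  by rewrite -(Quotient.idealrBE integers).
by rewrite -(Quotient.idealrBE integers).
Qed.

Lemma circle_normE_nonempty (c : circle) :
  [set `|a| | a in [set a : R | \pi_circle a = c]] !=set0.
Proof. by exists `|repr c|; exists (repr c) => //=; exact: reprK. Qed.

Lemma circle_norm_has_lbound (c : circle) :
  has_lbound [set `|a| | a in [set a : R | \pi_circle a = c]].
Proof. by exists 0 => _ [a _ <-]. Qed.

Lemma circle_norm_le (a : R) : circle_norm (\pi_circle a) <= `|a|.
Proof. by apply: ge_inf; [exact: circle_norm_has_lbound|exists a]. Qed.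

Lemma circle_norm_lt (c : circle) (e : R) :
  circle_norm c < e -> exists2 a : R, \pi_circle a = c & `|a| < e.
Proof.
by move=> /(inf_lt (circle_normE_nonempty c))[_ [a ac <-] ae]; exists a.
Qed.

Lemma circle_norm_ge0 (c : circle) : 0 <= circle_norm c.
Proof. by apply: lb_le_inf => [|_ [a _ <-]//]; exact: circle_normE_nonempty. Qed.

Lemma pi_circle0 : \pi_circle 0 = 0.
Proof. by rewrite -[in LHS](subrr 0) pi_circleD pi_circleN subrr. Qed.

Lemma circle_norm0 : circle_norm 0 = 0.
Proof.
apply/le_anti; rewrite circle_norm_ge0 andbT -pi_circle0.
by rewrite (le_trans (circle_norm_le _))// normr0.
Qed.

Lemma circle_normN (c : circle) : circle_norm (- c) = circle_norm c.
Proof.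
suff h (d : circle) : circle_norm (- d) <= circle_norm d.
  by apply/le_anti; rewrite h -[X in circle_norm X <= _]opprK h.
apply: lb_le_inf => [|_ [a <- <-]]; first exact: circle_normE_nonempty.
by rewrite -pi_circleN -normrN circle_norm_le.
Qed.

Lemma circle_normD (c d : circle) :
  circle_norm (c + d) <= circle_norm c + circle_norm d.
Proof.
apply/ler_addgt0Pr => e e0.
have e20 : 0 < e / 2 by rewrite divr_gt0.
have [a <- ac] : exists2 a : R, \pi_circle a = c & `|a| < circle_norm c + e / 2.
  by apply: circle_norm_lt; rewrite ltrDl.
have [b <- bd] : exists2 a : R, \pi_circle a = d & `|a| < circle_norm d + e / 2.
  by apply: circle_norm_lt; rewrite ltrDl.
rewrite -pi_circleD (le_trans (circle_norm_le _))// (le_trans (ler_normD _ _))//.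
rewrite [e]splitr addrACA; apply: lerD; exact: ltW.
Qed.

Lemma circle_norm_eq0 (c : circle) : circle_norm c = 0 -> c = 0.
Proof.
move=> c0; have [|a ac a1] := @circle_norm_lt c (1 / 2).
  by rewrite c0 divr_gt0.
have [a0|a0] := eqVneq a 0; first by rewrite -ac a0 pi_circle0.
have [|b bc ba] := @circle_norm_lt c `|a|; first by rewrite c0 normr_gt0.
have /pi_circle_eq abint : \pi_circle a = \pi_circle b by rewrite ac bc.
have ab0 : a - b != 0.
  by rewrite subr_eq0; apply: contraTneq ba => ->; rewrite ltxx.
have := norm_intr_ge1 abint ab0; rewrite leNgt => /negP[].
by rewrite (le_lt_trans (ler_normB _ _))// [ltRHS]splitr ltrD// (lt_trans ba).
Qed.

Lemma circle_norm_le1 (c : circle) : circle_norm c <= 1.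
Proof.
have -> : c = \pi_circle (repr c - (Num.floor (repr c))%:~R).
  rewrite -[LHS]reprK; apply/pi_circle_eq; rewrite subKr; exact: intr_int.
rewrite (le_trans (circle_norm_le _))// ger0_norm ?subr_ge0 ?floor_le_tmp//.
by rewrite lerBlDl; have := floorD1_gt (repr c); rewrite intrD => /ltW.
Qed.

Let circle_distxx (x : circle) : circle_dist x x = 0.
Proof. by rewrite /circle_dist subrr circle_norm0. Qed.

Let circle_dist_positivity (x y : circle) : circle_dist x y = 0 -> x = y.
Proof. by move=> /circle_norm_eq0/eqP; rewrite subr_eq0 => /eqP. Qed.

Let circle_dist_sym (x y : circle) : circle_dist x y = circle_dist y x.
Proof. by rewrite /circle_dist -circle_normN opprB. Qed.

Let circle_dist_triangle (y x z : circle) :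
  circle_dist x z <= circle_dist x y + circle_dist y z.
Proof. by rewrite /circle_dist (le_trans _ (circle_normD _ _))// subrKA. Qed.

HB.instance Definition _ := isMetric.Build R circle
  circle_distxx circle_dist_positivity circle_dist_sym circle_dist_triangle.

Lemma circle_mdistE (x y : circle) : mdist x y = circle_norm (x - y).
Proof. by []. Qed.

Lemma circle_mdist_le1 (x y : circle) : mdist x y <= 1.
Proof. exact: circle_norm_le1. Qed.

Lemma circle_mdistB (x y x' y' : circle) :
  mdist (x - y) (x' - y') <= mdist x x' + mdist y y'.
Proof.
rewrite !circle_mdistE opprD opprK addrACA (le_trans (circle_normD _ _))//.
by rewrite lerD2l -[leLHS]circle_normN opprD opprK.
Qed.

Let sub_continuous : continuous (fun x : circle * circle => x.1 - x.2).
Proof. by apply: nonexpansive_continuous => a b; exact: circle_mdistB. Qed.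

HB.instance Definition _ :=
  PreTopologicalNmodule_isTopologicalZmodule.Build circle sub_continuous.

End Circle.

Section Torus.
Context (R : realType).

Definition torus : Type := nat -> circle R.

HB.instance Definition _ := GRing.Zmodule.copy torus (nat -> circle R).

(* The coordinate of index [n] is [x(n+1)] when the coordinates are numbered
   from 1, whence the weight [2^-(n+1)]. *)
Definition torus_dist (x y : torus) : R :=
  limn (series (fun n => 2^-1 ^+ n.+1 * mdist (x n) (y n))).

Let term (x y : torus) n : R := 2^-1 ^+ n.+1 * mdist (x n) (y n).

Let term_ge0 x y n : 0 <= term x y n.
Proof. by rewrite mulr_ge0 ?mdist_ge0// exprn_ge0// invr_ge0. Qed.

Let term_le x y n : term x y n <= geometric (2^-1) (2^-1) n.
Proof.
rewrite /term /= -exprS ler_piMr ?circle_mdist_le1// exprn_ge0// invr_ge0//.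
Qed.

Let half_lt1 : `|2^-1 : R| < 1.
Proof. by rewrite ger0_norm ?invr_ge0// invf_lt1// ltr1n. Qed.

Let term_cvg x y : cvgn (series (term x y)).
Proof.
apply: (series_le_cvg (term_ge0 x y) _ (term_le x y)).
  by move=> n; rewrite geometric_ge0// invr_ge0.
exact: is_cvg_geometric_series.
Qed.

Lemma torus_dist_ge0 x y : 0 <= torus_dist x y.
Proof.
apply: limr_ge; first exact: term_cvg.
by apply: nearW => n; apply: sumr_ge0 => i _; exact: term_ge0.
Qed.

Lemma torus_dist_le1 x y : torus_dist x y <= 1.
Proof.
rewrite (le_trans (lim_series_le (@term_cvg x y) _ (term_le x y)))//.
  exact: is_cvg_geometric_series.
rewrite (cvg_lim _ (cvg_geometric_series half_lt1))//.
have -> : 1 - 2^-1 = 2^-1 :> R by rewrite {1}(splitr 1) div1r addrK.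
by rewrite mulfV// invr_eq0.
Qed.

Let torus_distxx x : torus_dist x x = 0.
Proof.
rewrite /torus_dist (_ : series _ = cst 0); last first.
  by apply/funext => n; rewrite /series/= big1// => i _; rewrite mdistxx mulr0.
by rewrite lim_cst.
Qed.

Let torus_dist_positivity x y : torus_dist x y = 0 -> x = y.
Proof.
move=> xy0; apply/funext => n.
have : term x y n <= torus_dist x y.
  rewrite (le_trans _ (nondecreasing_cvgn_le _ (@term_cvg x y) n.+1))//.
    rewrite /series/= big_nat_recr//= lerDr sumr_ge0//.
  exact: nondecreasing_series.
rewrite xy0 pmulr_rle0 ?exprn_gt0 ?invr_gt0// => xy.
by apply: mdist_positivity; apply/le_anti; rewrite xy mdist_ge0.
Qed.

Let torus_dist_sym x y : torus_dist x y = torus_dist y x.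
Proof.
by congr (limn (series _)); apply/funext => n; rewrite metric_sym.
Qed.

Lemma torus_distD (x z x1 y1 x2 y2 : torus) :
  (forall n, mdist (x n) (z n) <=
             mdist (x1 n) (y1 n) + mdist (x2 n) (y2 n)) ->
  torus_dist x z <= torus_dist x1 y1 + torus_dist x2 y2.
Proof.
move=> h; rewrite /torus_dist -lim_seriesD; [|exact: term_cvg..].
apply: lim_series_le; [exact: term_cvg| |].
  by apply: is_cvg_seriesD; exact: term_cvg.
move=> n; rewrite /= -mulrDr ler_wpM2l// exprn_ge0// invr_ge0//.
Qed.

Let torus_dist_triangle y x z :
  torus_dist x z <= torus_dist x y + torus_dist y z.
Proof. by apply: torus_distD => n; exact: metric_triangle. Qed.

HB.instance Definition _ := isMetric.Build R torus
  torus_distxx torus_dist_positivity torus_dist_sym torus_dist_triangle.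

Let sub_continuous : continuous (fun x : torus * torus => x.1 - x.2).
Proof.
apply: nonexpansive_continuous => a b; apply: torus_distD => n.
exact: circle_mdistB.
Qed.

HB.instance Definition _ :=
  PreTopologicalNmodule_isTopologicalZmodule.Build torus sub_continuous.

End Torus.

Section HausdorffDistance.
Context (R : realType) (M : metricType R).
Implicit Types (x y : M) (A B C : set M).

Definition dist_to_set x A : R := inf [set mdist x y | y in A].

Definition hausdorff_dist A B : R :=
  Num.max (sup [set dist_to_set x B | x in A])
          (sup [set dist_to_set y A | y in B]).

Lemma dist_to_set_le x A y : A y -> dist_to_set x A <= mdist x y.
Proof.
move=> Ay; apply: ge_inf; last by exists y.
by exists 0 => _ [z _ <-]; exact: mdist_ge0.
Qed.

Lemma dist_to_set_ge0 x A : 0 <= dist_to_set x A.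
Proof.
have [->|/set0P A0] := eqVneq A set0.
  by rewrite /dist_to_set image_set0 inf0.
apply: lb_le_inf => [|_ [z _ <-]]; last exact: mdist_ge0.
exact: image_nonempty.
Qed.

Lemma dist_to_set_lt x A (e : R) :
  A !=set0 -> dist_to_set x A < e -> exists2 y, A y & mdist x y < e.
Proof.
move=> A0 /inf_lt[|_ [y Ay <-] ye]; first exact: image_nonempty.
by exists y.
Qed.

Context (mdist_le1 : forall x y, mdist x y <= 1).

Lemma dist_to_set_le1 x A : A !=set0 -> dist_to_set x A <= 1.
Proof.
by move=> [y Ay]; apply: le_trans (mdist_le1 x y); exact: dist_to_set_le.
Qed.

Lemma hausdorff_dist_sym A B : hausdorff_dist A B = hausdorff_dist B A.
Proof. by rewrite /hausdorff_dist maxC. Qed.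

Lemma dist_to_set_le_hausdorff A B x :
  B !=set0 -> A x -> dist_to_set x B <= hausdorff_dist A B.
Proof.
move=> B0 Ax; rewrite /hausdorff_dist le_max; apply/orP; left.
apply: ub_le_sup; last by exists x.
by exists 1 => _ [z _ <-]; exact: dist_to_set_le1.
Qed.

Lemma hausdorff_dist_le A B (e : R) : A !=set0 -> B !=set0 ->
  (forall x, A x -> dist_to_set x B <= e) ->
  (forall y, B y -> dist_to_set y A <= e) -> hausdorff_dist A B <= e.
Proof.
move=> A0 B0 AB BA; rewrite /hausdorff_dist ge_max; apply/andP; split.
  by apply: ge_sup => [|_ [x Ax <-]]; [exact: image_nonempty|exact: AB].
by apply: ge_sup => [|_ [x Bx <-]]; [exact: image_nonempty|exact: BA].
Qed.

Lemma hausdorff_dist_ge0 A B : A !=set0 -> B !=set0 -> 0 <= hausdorff_dist A B.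
Proof.
move=> [x Ax] B0.
exact: le_trans (dist_to_set_ge0 x B) (dist_to_set_le_hausdorff B0 Ax).
Qed.

Lemma hausdorff_distxx A : A !=set0 -> hausdorff_dist A A = 0.
Proof.
move=> A0; apply/le_anti; rewrite hausdorff_dist_ge0// andbT.
by apply: hausdorff_dist_le => // x Ax; rewrite -(mdistxx x);
  exact: dist_to_set_le.
Qed.

Lemma hausdorff_dist_eq0_sub A B : B !=set0 -> closed B ->
  hausdorff_dist A B = 0 -> A `<=` B.
Proof.
move=> B0 cB AB0 x Ax; apply: cB => U /nbhs_ballP[e /= e0 eU].
have /(dist_to_set_lt B0)[y By xy] : dist_to_set x B < e.
  by rewrite (le_lt_trans (dist_to_set_le_hausdorff B0 Ax))// AB0.
by exists y; split => //; apply: eU; rewrite ballEmdist.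
Qed.

Let dist_to_set_triangle A B C x : A !=set0 -> B !=set0 -> C !=set0 ->
  A x -> dist_to_set x C <= hausdorff_dist A B + hausdorff_dist B C.
Proof.
move=> A0 B0 C0 Ax; apply/ler_addgt0Pr => e e0.
have /(dist_to_set_lt B0)[y By xy] :
    dist_to_set x B < hausdorff_dist A B + e / 2.
  by rewrite (le_lt_trans (dist_to_set_le_hausdorff B0 Ax))// ltrDl divr_gt0.
have /(dist_to_set_lt C0)[z Cz yz] :
    dist_to_set y C < hausdorff_dist B C + e / 2.
  by rewrite (le_lt_trans (dist_to_set_le_hausdorff C0 By))// ltrDl divr_gt0.
rewrite (le_trans (dist_to_set_le x Cz))// (le_trans (metric_triangle x y z))//.
by rewrite [e]splitr addrACA; apply: lerD; exact: ltW.
Qed.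

Lemma hausdorff_dist_triangle B A C : A !=set0 -> B !=set0 -> C !=set0 ->
  hausdorff_dist A C <= hausdorff_dist A B + hausdorff_dist B C.
Proof.
move=> A0 B0 C0; apply: hausdorff_dist_le => // x.
  exact: dist_to_set_triangle.
rewrite addrC hausdorff_dist_sym (hausdorff_dist_sym A).
exact: dist_to_set_triangle.
Qed.

End HausdorffDistance.

(* When [G] is compact Hausdorff, as the torus is, these are its nonempty
   compact subgroups. *)
Record closed_subgroup (G : topologicalZmodType) := ClosedSubgroup {
  closed_subgroup_subgroup :> subgroup G;
  closed_subgroup_closed : closed (closed_subgroup_subgroup : set G)
}.

Lemma subgroup_nonempty (G : zmodType) (K : subgroup G) : (K : set G) !=set0.
Proof. by exists 0; have [K0 _] := subgroup_zmod_closed K; rewrite inE in K0. Qed.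

Lemma closed_subgroup_eq (G : topologicalZmodType) (K L : closed_subgroup G) :
  (K : set G) `<=>` (L : set G) -> K = L.
Proof.
case: K L => [K cK] [L cL] /= /seteqP KL.
have {KL}KL : K = L.
  case: K L {cK cL} KL => [K zK] [L zL] /= KL.
  by case: _ / KL zL => zL; congr Subgroup; exact: Prop_irrelevance.
by case: _ / KL cL => cL; congr ClosedSubgroup; exact: Prop_irrelevance.
Qed.

Section ClosedSubgroupsOfTorus.
Context (R : realType).

Definition torus_subgroups : Type := closed_subgroup (torus R).

HB.instance Definition _ := gen_eqMixin torus_subgroups.
HB.instance Definition _ := gen_choiceMixin torus_subgroups.

Let dist (K L : torus_subgroups) : R := hausdorff_dist K L.

Let distxx K : dist K K = 0.
Proof.
by apply: hausdorff_distxx; [exact: torus_dist_le1|exact: subgroup_nonempty].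
Qed.

Let dist_positivity K L : dist K L = 0 -> K = L.
Proof.
move=> KL0; apply: closed_subgroup_eq; split.
  apply: hausdorff_dist_eq0_sub KL0;
    [exact: torus_dist_le1|exact: subgroup_nonempty|
     exact: closed_subgroup_closed].
rewrite /dist hausdorff_dist_sym in KL0.
apply: hausdorff_dist_eq0_sub KL0;
  [exact: torus_dist_le1|exact: subgroup_nonempty|
   exact: closed_subgroup_closed].
Qed.

Let dist_sym K L : dist K L = dist L K.
Proof. exact: hausdorff_dist_sym. Qed.

Let dist_triangle L K N : dist K N <= dist K L + dist L N.
Proof.
by apply: hausdorff_dist_triangle;
  [exact: torus_dist_le1|exact: subgroup_nonempty..].
Qed.

HB.instance Definition _ := isMetric.Build R torus_subgroups
  distxx dist_positivity dist_sym dist_triangle.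

End ClosedSubgroupsOfTorus.

Section PadicIntegers.
Context (p : {p : nat | prime p}).

Definition padic_digits : topologicalZmodType :=
  prod_topology (fun n : nat => discrete_topology 'Z_(\val p ^ n.+1)).

(* The inverse limit of the rings Z/p^(n+1): [x n.+1] reduces to [x n]. *)
Definition padic_coherent : set padic_digits := fun x => forall n,
  ((x n.+1 : 'Z_(\val p ^ n.+2)) : nat)%:R = x n :> 'Z_(\val p ^ n.+1).

Let pX_gt1 n : (1 < \val p ^ n.+1)%N.
Proof. by rewrite -{1}(exp1n n.+1) ltn_exp2r// prime_gt1// (valP p). Qed.

Fact padic_zmod_closed : zmod_closed (mem padic_coherent).
Proof.
split=> [|x y]; rewrite !inE; first by move=> n.
move=> xP yP n.
have redB (a b : 'Z_(\val p ^ n.+2)) : ((a - b)%R : nat)%:R =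
    (a : nat)%:R - (b : nat)%:R :> 'Z_(\val p ^ n.+1).
  have redD (c d : 'Z_(\val p ^ n.+2)) : ((c + d)%R : nat)%:R =
      (c : nat)%:R + (d : nat)%:R :> 'Z_(\val p ^ n.+1).
    rewrite -natrD [in RHS](divn_eq (c + d) (\val p ^ n.+2)) natrD natrM.
    rewrite [X in _ * X](_ : _ = 0) ?mulr0 ?add0r; last first.
      by rewrite [X in X%:R]expnS natrM pchar_Zp ?mulr0.
    by congr ((_ %% _)%N%:R); exact: Zp_cast.
  by apply: (addIr ((b : nat)%:R)); rewrite -redD !subrK.
by rewrite -[RHS]/((x n : 'Z_(\val p ^ n.+1)) - y n) -xP -yP -redB.
Qed.

Definition padic_subgroup : subgroup padic_digits :=
  Subgroup padic_zmod_closed.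

Definition padic_int : topologicalZmodType := subgroup_type padic_subgroup.

End PadicIntegers.

Definition prod_padics : topologicalZmodType :=
  prod_topology (fun p : {p : nat | prime p} =>
    prod_topology (fun _ : nat => padic_int p)).

(* Main.v *)
(* Let [D] be the group of characters of [K], which is generated by the
   coordinates. The following conditions are open in [K], because the circle has
   no small subgroups: a given character is torsion on [K]; a given character is
   divisible by [m] in [D]; [D] has a character of order [p] outside a given
   finite list. They are dense, because finite subgroups are dense and a finite
   subgroup can be enlarged in faraway coordinates. Hence for generic [K] the
   group [D] is a countable divisible torsion group of infinite [p]-rank for
   every [p], that is, a direct sum of Prüfer groups [Z(p^oo)], each occurring
   infinitely often. The towers [phi p i n] of characters of order [p^(n+1)]
   spanning these summands assemble into a map from [K] to the product of the
   [Z_p]: it is injective because they generate [D], and surjective by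
   compactness, because finitely many independent characters admit a dual system
   of points of [K]. *)

From HB Require Import structures.
Require Import Defs.
From mathcomp Require Import all_boot all_order all_algebra generic_quotient.
From mathcomp Require Import all_classical all_reals all_analysis.
From mathcomp Require Import ring lra.

Set Implicit Arguments.
Unset Strict Implicit.
Unset Printing Implicit Defensive.

Import Order.TTheory GRing.Theory Num.Theory.
Import numFieldNormedType.Exports.

Local Open Scope classical_set_scope.
Local Open Scope ring_scope.
Local Open Scope quotient_scope.

Lemma mulrn_modn (V : zmodType) (x : V) m k :
  x *+ m = 0 -> x *+ (k %% m) = x *+ k.
Proof.
by move=> xm; rewrite [in RHS](divn_eq k m) mulrnDr mulnC mulrnA xm mul0rn add0r.
Qed.

(** * Norm and torsion elements of the circle *)

Section CircleTheory.
Context {R : realType}.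
Implicit Types (a b : R) (c d : circle R).

Local Notation pic := \pi_(circle R).

Lemma pi_circleMn a n : pic (a *+ n) = pic a *+ n.
Proof.
elim: n => [|n IH]; first by rewrite !mulr0n pi_circle0.
by rewrite !mulrS pi_circleD IH.
Qed.

Lemma circle_norm_pi a : `|a| <= 1 / 2 -> circle_norm (pic a) = `|a|.
Proof.
move=> a2; apply/le_anti; rewrite circle_norm_le/=.
apply: lb_le_inf => [|_ [b /= /esym/pi_circle_eq abint <-]].
  exact: circle_normE_nonempty.
have [->//|ab] := eqVneq a b.
have : 1 <= `|a - b| by rewrite norm_intr_ge1// subr_eq0.
have := ler_normB a b; lra.
Qed.

Lemma circle_normMn c n : circle_norm (c *+ n) <= circle_norm c *+ n.
Proof.
elim: n => [|n IH]; first by rewrite !mulr0n circle_norm0.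
by rewrite !mulrS (le_trans (circle_normD _ _))// lerD2l.
Qed.

Lemma circle_normMz c (z : int) : circle_norm (c *~ z) <= circle_norm c *+ `|z|.
Proof.
by case: z => n; rewrite ?NegzE ?mulrNz ?circle_normN; exact: circle_normMn.
Qed.

Lemma circle_norm_attained c : exists2 a, pic a = c & `|a| = circle_norm c.
Proof.
suff [a [<-] a2] : exists a, pic a = c /\ `|a| <= 1 / 2.
  by exists a => //; rewrite circle_norm_pi.
have cE := reprK c; set b := repr c in cE.
have := floor_le_tmp b; have := floorD1_gt b; rewrite intrD.
set f := (Num.floor b)%:~R => b1 b0.
have [h|h] := leP (b - f) (1 / 2).
  exists (b - f); split; last by rewrite ger0_norm; lra.
  by rewrite -cE; apply/pi_circle_eq; rewrite addrAC subrr sub0r rpredN intr_int.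
exists (b - f - 1); split; last by rewrite ler0_norm; lra.
rewrite -cE; apply/pi_circle_eq.
have -> : b - f - 1 - b = - (f + 1) by ring.
by rewrite rpredN rpredD ?intr_int// rpred1.
Qed.

Lemma pi_circle_eq0 a : (pic a = 0) <-> a \is a Num.int.
Proof. by rewrite -pi_circle0 pi_circle_eq subr0. Qed.

(** For a shortest representative [a] of [c], the number [a *+ m] is an integer of absolute value
    less than 1. *)
Lemma torsion_norm_lt c m :
  (0 < m)%N -> c *+ m = 0 -> circle_norm c *+ m < 1 -> c = 0.
Proof.
have [a <- <-] := circle_norm_attained c => m0.
rewrite -pi_circleMn => /pi_circle_eq0 ami am1.
have : a *+ m = 0.
  apply/eqP; apply: contraTT am1 => am0.
  by rewrite -leNgt -normrMn norm_intr_ge1.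
by move/eqP; rewrite mulrn_eq0 eqn0Ngt m0/= => /eqP ->; rewrite pi_circle0.
Qed.

Lemma circle_norm_double c :
  circle_norm c <= 1 / 4 -> circle_norm (c *+ 2) = circle_norm c *+ 2.
Proof.
have [a <- <-] := circle_norm_attained c => a4.
by rewrite -pi_circleMn circle_norm_pi normrMn//; lra.
Qed.

(** Doubling an element of norm at most 1/4 doubles its norm, so repeated doubling would drive a
    nonzero element out of the ball of radius 1/4. *)
Lemma circle_no_small_subgroup c :
  (forall n, circle_norm (c *+ n) <= 1 / 4) -> c = 0.
Proof.
move=> h; apply: circle_norm_eq0; apply/le_anti; rewrite circle_norm_ge0 andbT.
rewrite leNgt; apply/negP => c0.
have normX n : circle_norm (c *+ 2 ^ n) = circle_norm c *+ 2 ^ n.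
  elim: n => [|n IH]; first by rewrite expn0 !mulr1n.
  by rewrite expnSr !mulrnA circle_norm_double ?IH// -IH.
(* With [n] above the inverse of the norm, $2^n > n$ makes the [2 ^ n]-fold norm at least 1. *)
pose n := (Num.truncn (circle_norm c)^-1).+1.
have : circle_norm c *+ 2 ^ n <= 1 / 4 by rewrite -normX.
apply/negP; rewrite -ltNge (lt_le_trans (_ : _ < 1))//; first by lra.
have : (circle_norm c)^-1 <= n%:R by rewrite ltW// truncnS_gt.
rewrite -(ler_pM2l c0) mulfV ?gt_eqF// => /le_trans; apply.
by rewrite mulr_natr; apply: ler_wpMn2l; [exact: ltW|exact/ltnW/ltn_expl].
Qed.

Definition circle_root (m : nat) : circle R := pic (m%:R^-1).

Lemma circle_root_torsion m : (0 < m)%N -> circle_root m *+ m = 0.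
Proof.
move=> m0; rewrite -pi_circleMn; apply/pi_circle_eq0.
by rewrite -[_ *+ m]mulr_natr mulVf ?rpred1// pnatr_eq0 -lt0n.
Qed.

Lemma circle_rootM (m d : nat) : (0 < d)%N ->
  circle_root (m * d) *+ d = circle_root m.
Proof.
move=> d0; rewrite /circle_root -pi_circleMn; congr pic.
by rewrite -[_ *+ d]mulr_natr natrM invfM mulfVK// pnatr_eq0 -lt0n.
Qed.

Lemma torsion_circle_root c m : (0 < m)%N ->
  c *+ m = 0 -> exists k, c = circle_root m *+ k.
Proof.
move=> m0; rewrite -[c]reprK -pi_circleMn => /pi_circle_eq0.
set a := repr c => /intrP[z az].
have mR : (m%:R : R) != 0 by rewrite pnatr_eq0 -lt0n.
(* The numerator [z] is reduced modulo [m] to a natural number; the quotient is an integer, which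
   vanishes in the circle. *)
exists (`|(z %% m)%Z|)%N; rewrite -pi_circleMn; apply/pi_circle_eq.
have -> : a = z%:~R / m%:R by rewrite -az -[_ *+ m]mulr_natr mulfK.
rewrite -[_ *+ `|_|]mulr_natl -mulrBl -[`|_|%:R]/(Posz `|(z %% m)%Z|%N)%:~R.
rewrite gez0_abs ?modz_ge0//; last by rewrite -lt0n.
rewrite {1}(divz_eq z m) intrD addrK intrM mulfK//; exact: intr_int.
Qed.

Lemma circle_root_eq0 m k : (0 < m)%N ->
  (circle_root m *+ k = 0) <-> (m %| k)%N.
Proof.
move=> m0; split => [|/dvdnP[j ->]]; last first.
  by rewrite mulnC mulrnA circle_root_torsion// mul0rn.
rewrite -(mulrn_modn k (circle_root_torsion m0)) -pi_circleMn.
move=> /pi_circle_eq0 h; rewrite /dvdn.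
have km : (k %% m < m)%N by rewrite ltn_mod.
have mR : (0 : R) < m%:R by rewrite ltr0n.
suff : (m%:R^-1 *+ (k %% m) : R) = 0.
  by move/eqP; rewrite mulrn_eq0 invr_eq0 (gt_eqF mR) orbF.
apply/eqP; apply: contraTT isT => a0.
have := norm_intr_ge1 h a0.
rewrite ger0_norm ?mulrn_wge0 ?invr_ge0 ?ler0n//.
rewrite -[_ *+ (k %% m)]mulr_natl ler_pdivlMr// mul1r.
by rewrite ler_nat leqNgt km.
Qed.

Lemma circle_root_inj m k l : (0 < m)%N ->
  circle_root m *+ k = circle_root m *+ l -> (k = l %[mod m])%N.
Proof.
move=> m0; wlog kl : k l / (l <= k)%N.
  by move=> h; case: (leqP l k) => [/h//|/ltnW/h + /esym h']; move/(_ h')/esym.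
move=> /eqP; rewrite -subr_eq0 -mulrnBr// => /eqP/circle_root_eq0.
by move=> /(_ m0); rewrite -eqn_mod_dvd// => /eqP.
Qed.

(** Subtract [b / q] from [c], where [b] is a shortest representative of [c *+ q]. *)
Lemma circle_approx_torsion c q e : (0 < q)%N -> circle_norm (c *+ q) < e ->
  exists2 c', c' *+ q = 0 & circle_norm (c - c') *+ q < e.
Proof.
move=> q0; have [b bc <-] := circle_norm_attained (c *+ q) => be.
have qR : (0 : R) < q%:R by rewrite ltr0n.
have bq : (b / q%:R) *+ q = b by rewrite -[_ *+ q]mulr_natr mulfVK// gt_eqF.
exists (c - pic (b / q%:R)).
  by rewrite mulrnBl -pi_circleMn bq bc subrr.
rewrite opprB addrC subrK (le_lt_trans _ be)//.
rewrite -[in leRHS]bq normrMn lerMn2r; apply/orP; right; exact: circle_norm_le.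
Qed.

(** The cells are [s] half-open arcs of length 1/s, at most [e]. Finite partitions of this kind
    serve for pigeonhole arguments and finite nets. *)
Lemma circle_cells e : 0 < e -> exists (C : finType) (cell : circle R -> C),
  forall c d, cell c = cell d -> circle_norm (c - d) <= e.
Proof.
move=> e0; pose s := (Num.truncn e^-1).+1.
have s0 : (0 : R) < s%:R by rewrite ltr0n.
have es : s%:R^-1 <= e by rewrite invf_ple ?posrE// ltW// truncnS_gt.
pose fr c := repr c - (Num.floor (repr c))%:~R.
have frE c : pic (fr c) = c.
  rewrite -[RHS]reprK; apply/pi_circle_eq.
  by rewrite addrAC subrr sub0r rpredN intr_int.
have fr0 c : 0 <= fr c by rewrite subr_ge0 floor_le_tmp.
have fr1 c : fr c < 1.
  by rewrite ltrBlDl; have := floorD1_gt (repr c); rewrite intrD.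
exists 'I_s, (fun c => inord (Num.truncn (s%:R * fr c))) => c d.
move=> /(congr1 (@nat_of_ord _)).
have lts c' : (Num.truncn (s%:R * fr c') < s)%N.
  rewrite -(ltr_nat R) (le_lt_trans (_ : _ <= s%:R * fr c'))//.
    by rewrite truncn_le mulr_ge0 ?fr0.
  by rewrite gtr_pMr.
rewrite !inordK// => cd.
rewrite -(frE c) -(frE d) -pi_circleN -pi_circleD (le_trans (circle_norm_le _))//.
apply: le_trans es; rewrite -[leRHS]mul1r ler_pdivlMr//.
rewrite -[X in _ * X](ger0_norm (ltW s0)).
rewrite -normrM.
have h c' : 0 <= s%:R * fr c' by rewrite mulr_ge0 ?fr0.
have := truncn_itv (h c); have := truncn_itv (h d); rewrite -cd.
set t := Num.truncn _ => /andP[d1 d2] /andP[c1 c2].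
move: d2 c2; rewrite -addn1 natrD => d2 c2.
rewrite ler_norml mulrBl ![_ * s%:R]mulrC; lra.
Qed.

End CircleTheory.

(** * Metric estimates and characters on the torus *)

Section TorusTheory.
Context {R : realType}.
Implicit Types (x y : torus R) (P Q : {poly int}).

Lemma torusMn x m n : (x *+ m) n = x n *+ m.
Proof. by elim: m => [//|m IH]; rewrite !mulrS -IH. Qed.

Let geom_half_le1 n : series (fun n => 2^-1 ^+ n.+1 : R) n = 1 - 2^-1 ^+ n.
Proof.
elim: n => [|n IH]; first by rewrite /series/= big_geq// expr0 subrr.
rewrite seriesS IH exprS; lra.
Qed.

Let term x y n : R := 2^-1 ^+ n.+1 * mdist (x n) (y n).

Let term_ge0 x y n : 0 <= term x y n.
Proof. by rewrite mulr_ge0 ?mdist_ge0// exprn_ge0// invr_ge0. Qed.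

Let series_le1 x y n : series (term x y) n <= 1.
Proof.
apply: (@le_trans _ _ (series (fun n => 2^-1 ^+ n.+1 : R) n)).
  apply: ler_sum => i _.
  by rewrite /term ler_piMr ?circle_mdist_le1// exprn_ge0// invr_ge0.
by rewrite geom_half_le1 gerBl exprn_ge0// invr_ge0.
Qed.

Let term_cvg x y : cvgn (series (term x y)).
Proof.
apply: nondecreasing_is_cvgn; first exact: nondecreasing_series.
by exists 1 => _ [n _ <-]; exact: series_le1.
Qed.

Lemma torus_dist_coord x y n :
  circle_norm (x n - y n) <= 2 ^+ n.+1 * mdist x y.
Proof.
have : term x y n <= mdist x y.
  rewrite (le_trans _ (nondecreasing_cvgn_le _ (@term_cvg x y) n.+1))//.
    by rewrite seriesS lerDl sumr_ge0.
  exact: nondecreasing_series.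
by rewrite /term exprVn ler_pdivrMl// exprn_gt0.
Qed.

(** The first [N] weights sum to less than 1, and the remaining ones to $2^{-N}$ with all coordinate
    distances at most 1. *)
Lemma torus_dist_trunc x y N e : 0 <= e ->
  (forall n, (n < N)%N -> circle_norm (x n - y n) <= e) ->
  mdist x y <= e + 2^-1 ^+ N.
Proof.
move=> e0 xy; apply: limr_le; first exact: term_cvg.
have h0 n : (0 : R) <= 2^-1 ^+ n by rewrite exprn_ge0// invr_ge0.
have lo n : (n <= N)%N -> series (term x y) n <= e * (1 - 2^-1 ^+ n).
  elim: n => [_|n IH nN]; first by rewrite /series/= big_geq// expr0 subrr mulr0.
  rewrite seriesS (_ : e * _ = 2^-1 ^+ n.+1 * e + e * (1 - 2^-1 ^+ n)).
    by rewrite lerD ?IH 1?ltnW// /term ler_wpM2l ?xy.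
  by rewrite exprS; lra.
have hi n : series (term x y) (N + n)%N <= e + (2^-1 ^+ N - 2^-1 ^+ (N + n)%N).
  elim: n => [|n IH].
    by rewrite addn0 subrr addr0 (le_trans (lo _ _))// ler_piMr// gerBl.
  rewrite addnS seriesS exprS.
  have : term x y (N + n)%N <= 2^-1 ^+ (N + n).+1.
    by rewrite /term ler_piMr ?circle_mdist_le1.
  by rewrite exprS; move: IH; lra.
near=> n; have nN : (N <= n)%N by near: n; exact: nbhs_infty_ge.
by rewrite -(subnKC nN) (le_trans (hi _))// lerD2l gerBl.
Unshelve. all: by end_near. Qed.

(* Characters of the torus are encoded by integer polynomials, the coefficient
   of ['X^n] being the exponent of the coordinate [n]. *)
Definition torus_char P x : circle R := \sum_(i < size P) x i *~ P`_i.

Lemma torus_charE n P x : (size P <= n)%N ->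
  torus_char P x = \sum_(i < n) x i *~ P`_i.
Proof.
move=> Pn; rewrite /torus_char (big_ord_widen n (fun i => x i *~ P`_i))//.
rewrite big_mkcond; apply: eq_bigr => i _; case: ltnP => // h.
by rewrite nth_default// mulr0z.
Qed.

Lemma torus_charD P Q x : torus_char (P + Q) x = torus_char P x + torus_char Q x.
Proof.
pose n := maxn (size P) (size Q).
rewrite !(@torus_charE n) ?leq_maxl ?leq_maxr//; last exact: size_polyD.
rewrite -big_split; apply: eq_bigr => i _ /=.
by rewrite coefD mulrzDr.
Qed.

Lemma torus_charDr P x y : torus_char P (x + y) = torus_char P x + torus_char P y.
Proof. by rewrite /torus_char -big_split; apply: eq_bigr => i _; rewrite mulrzDl. Qed.

Lemma torus_charXn n x : torus_char 'X^n x = x n.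
Proof.
rewrite /torus_char size_polyXn big_ord_recr/= big1 ?add0r.
  by rewrite coefXn eqxx mulr1z.
by move=> i _; rewrite coefXn ltn_eqF// mulr0z.
Qed.

Lemma torus_char_lip P : exists2 C : R, 0 < C & forall x y,
  circle_norm (torus_char P x - torus_char P y) <= C * mdist x y.
Proof.
pose C : R := \sum_(i < size P) 2 ^+ i.+1 *+ `|P`_i|.
have C0 : 0 <= C by apply: sumr_ge0 => i _; rewrite mulrn_wge0// exprn_ge0.
(* Adding 1 keeps the constant positive for the zero polynomial. *)
exists (C + 1) => [|x y]; first by rewrite ltr_wpDl.
apply: (@le_trans _ _ (C * mdist x y)); last first.
  by rewrite ler_wpM2r ?mdist_ge0// lerDl.
rewrite /torus_char -sumrB /C mulr_suml.
elim/big_rec2: _ => [|i c r _ IH]; first by rewrite circle_norm0.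
rewrite (le_trans (circle_normD _ _))// lerD// -mulrzBl.
rewrite (le_trans (circle_normMz _ _))// mulrnAl lerMn2r torus_dist_coord orbT//.
Qed.

End TorusTheory.

(** * Continuity and compactness on the torus *)

Lemma half_exp_lt (R : realType) (e : R) : 0 < e -> exists N, 2^-1 ^+ N < e.
Proof.
move=> e0; exists (Num.truncn e^-1).+1; set N := _.+1.
rewrite exprVn invf_plt ?posrE ?exprn_gt0//.
rewrite (lt_trans (truncnS_gt _))// -natrX ltr_nat; exact: ltn_expl.
Qed.

Lemma continuous_torus (R : realType) (Y : topologicalType) (f : Y -> torus R) :
  (forall n, continuous (fun y => f y n)) -> continuous f.
Proof.
move=> fc y; apply/metricType_numDomainType.cvgrPdist_lt => e e0.
have [N Ne] := @half_exp_lt _ (e / 2) (divr_gt0 e0 (ltr0Sn _ _)).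
have : \forall y' \near y, forall i : 'I_N,
    circle_norm (f y i - f y' i) < e / 2.
  apply: filter_forall => i.
  have /metricType_numDomainType.cvgrPdist_lt := fc i y.
  by apply; rewrite divr_gt0.
apply: filterS => y' h.
rewrite (le_lt_trans (torus_dist_trunc (e := e / 2) (N := N) _ _))//.
- by rewrite divr_ge0 ?ltW.
- by move=> n nN; rewrite ltW// (h (Ordinal nN)).
- by rewrite [ltRHS]splitr ltrD2l.
Qed.

Lemma lipschitz_continuous_metric (R : realType) (M N : metricType R)
    (f : M -> N) (C : R) : 0 < C ->
  (forall x y, mdist (f x) (f y) <= C * mdist x y) -> continuous f.
Proof.
move=> C0 lip x; apply/metricType_numDomainType.cvgrPdist_lt => e e0.
apply/nbhs_ballP; exists (e / C) => [|y]; first by rewrite /= divr_gt0.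
rewrite ballEmdist /= => xy.
by rewrite (le_lt_trans (lip _ _))// mulrC -ltr_pdivlMr.
Qed.

Lemma continuous_torus_char (R : realType) (P : {poly int}) :
  continuous (@torus_char R P).
Proof.
have [C C0 lip] := @torus_char_lip R P.
exact: (@lipschitz_continuous_metric R (torus R) (circle R) _ _ C0 lip).
Qed.

Lemma compact_circle (R : realType) : compact [set: circle R].
Proof.
pose f (a : R) : circle R := \pi_(circle R) a.
have fc : continuous f.
  move=> a; apply/metricType_numDomainType.cvgrPdist_lt => e e0.
  have : \forall b \near a, `|a - b| < e.
    by have /cvgrPdist_lt := (@cvg_id _ (nbhs a)); apply.
  apply: filterS => b ab; rewrite circle_mdistE -pi_circleN -pi_circleD.
  by rewrite (le_lt_trans (circle_norm_le _)).
rewrite (_ : [set: _] = f @` `[(-1)%R, 1%R]).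
  apply: continuous_compact; last exact: segment_compact.
  by apply: continuous_subspaceT.
apply/esym/seteqP; split => // c _; have [a ac an] := circle_norm_attained c.
exists a => //=; rewrite in_itv/= -ler_norml an; exact: circle_norm_le1.
Qed.

(** The identity map from the product topology, compact by Tychonoff's theorem, to the metric
    topology is continuous. *)
Lemma compact_torus (R : realType) : compact [set: torus R].
Proof.
pose T := prod_topology (fun _ : nat => circle R).
pose f (z : T) : torus R := z.
have fc : continuous f.
  apply: continuous_torus => n.
  exact: (@proj_continuous _ (fun _ : nat => circle R) n).
rewrite (_ : [set: _] = f @` [set z : T | forall i, [set: circle R] (z i)]).
  apply: (@continuous_compact T (torus R) f); first exact: continuous_subspaceT.

  exact: (@tychonoff nat _ (fun _ => setT) (fun _ => @compact_circle R)).
by apply/esym/seteqP; split => // z _; exists z.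
Qed.

Lemma torus_cells (R : realType) N (e : R) : 0 < e ->
  exists (C : finType) (cell : torus R -> C),
  forall x y, cell x = cell y ->
    forall n, (n < N)%N -> circle_norm (x n - y n) <= e.
Proof.
move=> /circle_cells[C [cell cellP]].
exists {ffun 'I_N -> C}, (fun x => [ffun i : 'I_N => cell (x i)]).
move=> x y /ffunP xy n nN; apply: cellP.
by have := xy (Ordinal nN); rewrite !ffunE.
Qed.

(** * Annihilators of closed subgroups and open conditions *)

Section Characters.
Context {R : realType}.
Implicit Types (x y : torus R) (P Q : {poly int}).

Fact torus_char_is_zmod_morphism P :
  {morph (@torus_char R P) : x y / x - y}.
Proof.
by move=> x y; apply: (addIr (torus_char P y)); rewrite -torus_charDr !subrK.
Qed.

HB.instance Definition _ P := GRing.isZmodMorphism.Build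
  (torus R) (circle R) (torus_char P) (torus_char_is_zmod_morphism P).

Lemma torus_char0l x : torus_char 0 x = 0.
Proof. by apply: (addIr (torus_char 0 x)); rewrite -torus_charD !add0r. Qed.

Lemma torus_charMnl P n x : torus_char (P *+ n) x = torus_char P x *+ n.
Proof.
elim: n => [|n IH]; first by rewrite !mulr0n torus_char0l.
by rewrite !mulrS torus_charD IH.
Qed.

Lemma torus_charBl P Q x : torus_char (P - Q) x = torus_char P x - torus_char Q x.
Proof. by apply: (addIr (torus_char Q x)); rewrite -torus_charD !subrK. Qed.

(** Two characters [P] and [Q] agree on [K] exactly when [P - Q] annihilates [K]; conditions on the
    dual group of [K] are expressed in this way. *)
Definition annihilates (K : set (torus R)) P :=
  forall x, K x -> torus_char P x = 0.

Lemma hausdorff_near (K L : torus_subgroups R) e x :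
  mdist K L < e -> (K : set _) x -> exists2 y, (L : set _) y & mdist x y < e.
Proof.
move=> KL Kx; apply: dist_to_set_lt; first exact: subgroup_nonempty.
apply: le_lt_trans KL; apply: dist_to_set_le_hausdorff => //.
  exact: torus_dist_le1.
exact: subgroup_nonempty.
Qed.

Lemma subgroupMn (G : zmodType) (K : subgroup G) (x : G) n :
  (K : set G) x -> (K : set G) (x *+ n).
Proof.
have [K0 KB] := subgroup_zmod_closed K.
move=> Kx; elim: n => [|n IH]; first by rewrite inE in K0.
suff : x *+ n.+1 \in (K : set G) by rewrite inE.
rewrite mulrS -[x *+ n]opprK -[- - _]/(- (- (x *+ n))).
by apply/KB; [rewrite inE|rewrite -sub0r; apply/KB => //; rewrite inE].
Qed.

Lemma subgroupD (G : zmodType) (K : subgroup G) (x y : G) :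
  (K : set G) x -> (K : set G) y -> (K : set G) (x + y).
Proof.
have [K0 KB] := subgroup_zmod_closed K.
move=> Kx Ky; suff : x + y \in (K : set G) by rewrite inE.
rewrite -[y]opprK.
by apply/KB; [rewrite inE|rewrite -sub0r; apply/KB => //; rewrite inE].
Qed.

Lemma subgroup0 (G : zmodType) (K : subgroup G) : (K : set G) 0.
Proof. by have [] := subgroup_zmod_closed K; rewrite inE. Qed.

(** All multiples of a point of a nearby [L] stay in [L], hence close to [K], where [P] vanishes. So
    [P] maps them into the ball of radius 1/4, which contains no nontrivial subgroup. *)
Lemma open_annihilates P : open [set K : torus_subgroups R | annihilates K P].
Proof.
rewrite openE => K /= KP; have [C C0 lip] := @torus_char_lip R P.
have C40 : 0 < C * 4 by rewrite mulr_gt0.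
apply/nbhs_ballP; exists (C * 4)^-1 => [|L]; first by rewrite /= invr_gt0.
rewrite ballEmdist /= metric_sym => LK x Lx.
apply: circle_no_small_subgroup => n; rewrite -raddfMn.
have [y Ky xy] := hausdorff_near LK (subgroupMn n Lx).
have := lip (x *+ n) y; rewrite (KP _ Ky) subr0 => /le_trans; apply.
by rewrite -ler_pdivlMl// div1r -invfM ltW.
Qed.

Lemma open_not_annihilates P :
  open [set K : torus_subgroups R | ~ annihilates K P].
Proof.
rewrite openE => K /= /existsNP[x /not_implyP[Kx Px]].
have [C C0 lip] := @torus_char_lip R P.
have Px0 : 0 < circle_norm (torus_char P x).
  by rewrite lt_neqAle circle_norm_ge0 andbT eq_sym; apply/eqP => /circle_norm_eq0.
apply/nbhs_ballP; exists (circle_norm (torus_char P x) / C) => [|L].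
  by rewrite /= divr_gt0.
rewrite ballEmdist /= => KL LP.
have [y Ly xy] := hausdorff_near KL Kx.
have := lip x y; rewrite (LP _ Ly) subr0 leNgt mulrC -ltr_pdivlMr//.
by rewrite xy.
Qed.

End Characters.

(** * Approximation by finite subgroups *)

Section Density.
Context {R : realType}.
Implicit Types (x y z : torus R) (P Q : {poly int}).

(** One point of [K] is chosen in each of the finitely many cells that [K] meets; 0 is the default
    for the other cells. *)
Lemma torus_net (K : torus_subgroups R) N (e : R) : 0 < e ->
  exists k (a : 'I_k -> torus R), (forall i, (K : set _) (a i)) /\
    forall x, (K : set _) x ->
      exists i, forall n, (n < N)%N -> circle_norm (x n - a i n) <= e.
Proof.
move=> /(torus_cells N)[C [cell cellP]].
have : forall c, exists x, (K : set _) x /\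
    ((exists2 z, (K : set _) z & cell z = c) -> cell x = c).
  move=> c; have [[z Kz zc]|h] := pselect (exists2 z, (K : set _) z & cell z = c).
    by exists z.
  by exists 0; split; [exact: subgroup0|].
move=> /choice[a aP]; exists #|C|, (a \o enum_val); split=> [i|x Kx].
  by have [] := aP (enum_val i).
exists (enum_rank (cell x)) => n nN /=; rewrite enum_rankK; apply: cellP nN.
by have [_ ->] := aP (cell x) => //; exists x.
Qed.

(** By the pigeonhole principle, two multipliers [j] and [l] send every [a i] to a common cell; [q]
    is their difference. *)
Lemma simultaneous_dirichlet (I : finType) (a : I -> torus R) N (e : R) :
  0 < e -> exists2 q, (0 < q)%N &
    forall i n, (n < N)%N -> circle_norm (a i n *+ q) <= e.
Proof.
move=> /(torus_cells N)[C [cell cellP]].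
pose f (j : 'I_#|{ffun I -> C}|.+1) := [ffun i : I => cell (a i *+ j)].
have /injectivePn[j [l jl fjl]] : ~~ injectiveb f.
  by apply/injectiveP => /leq_card; rewrite card_ord ltnn.
wlog lj : j l jl fjl / (l < j)%N.
  move=> h; case: (ltngtP l j) => [lj|jl'|/val_inj ljE]; first exact: h lj.
  - by apply: (h l j) => //; rewrite eq_sym.
  - by rewrite ljE eqxx in jl.
exists (j - l)%N => [|i n nN]; first by rewrite subn_gt0.
have := cellP _ _ _ n nN.
move: fjl => /ffunP/(_ i); rewrite !ffunE => /[swap] /[apply].
by rewrite !torusMn mulrnBr// ltnW.
Qed.

(* Finitely generated torsion subgroups are dense: Dirichlet's theorem gives [q]
   for which the points [q a_i] of a finite net [a_i] of [K] are tiny, so that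
   each [a_i] can be moved by [1/q] times that to a point killed by [q]. The new
   coordinates [N + i], too far to affect the distance, make the generators free
   over [Z/mq]; the generator [x_k = 0] has no other coordinate. *)
Lemma torsion_approx (K : torus_subgroups R) (e : R) N0 m : 0 < e -> (0 < m)%N ->
  exists N k q (x : 'I_k.+1 -> torus R) (L : torus_subgroups R),
    let y i : torus R :=
      fun n => x i n + (if n == (N + i)%N then circle_root (m * q) else 0) in
    [/\ (N0 <= N)%N, (0 < q)%N, mdist K L < e,
        [/\ forall i, x i *+ q = 0, forall i, y i *+ (m * q) = 0,
            forall i n, (N <= n)%N -> x i n = 0 & x ord_max = 0]
      & forall P, annihilates L P <-> forall i, torus_char P (y i) = 0].
Proof.
move=> e0 m0.
(* The error budget is e/8 for the net, e/8 for moving its points, and e/4 for the coordinates from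
   [N] on. *)
have e8 : 0 < e / 8 by rewrite divr_gt0.
have [N1 N1e] := @half_exp_lt R (e / 4) (divr_gt0 e0 (ltr0Sn _ _)).
pose N := maxn N0 N1.
have Ne : 2^-1 ^+ N < e / 4.
  apply: le_lt_trans N1e; apply: ler_wiXn2l; last exact: leq_maxr.
    by rewrite invr_ge0.
  by rewrite invf_le1// ler1n.
have [k [a0 [Ka0 a0P]]] := torus_net K N e8.
pose a (i : 'I_k.+1) := if unlift ord_max i is Some j then a0 j else 0.
have Ka i : (K : set _) (a i).
  by rewrite /a; case: unliftP => // _; exact: subgroup0.
(* An element of [L] is a combination of [k.+1] generators, and each of them may contribute an error
   of [d]. *)
pose d := e / 8 / k.+1%:R.
have d0 : 0 < d by rewrite divr_gt0// ltr0n.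
have dk : d *+ k.+1 = e / 8 by rewrite -[_ *+ _]mulr_natr mulfVK.
have dle : d <= e / 8.
  by rewrite -dk -[leLHS]mulr1n; apply: ler_wpMn2l; rewrite ?ltW.
have [q q0 qP] := @simultaneous_dirichlet _ a N (d / 2) (divr_gt0 d0 (ltr0Sn _ _)).
have : forall u : 'I_k.+1 * nat, exists c, [/\ c *+ q = 0,
    (u.2 < N)%N -> circle_norm (a u.1 u.2 - c) *+ q < d,
    (N <= u.2)%N -> c = 0 & u.1 = ord_max -> c = 0].
  move=> [i n] /=; case: (ltnP n N) => nN; last by exists 0; rewrite mul0rn.
  have [->|imax] := eqVneq i ord_max.
    exists 0; rewrite mul0rn; split => // _.
    by rewrite /a unlift_none subrr circle_norm0 mul0rn.
  have [|c cq cd] := @circle_approx_torsion _ (a i n) q d q0.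
    by rewrite (le_lt_trans (qP _ _ nN))// gtr_pMr// invf_lt1// ltr1n.
  by exists c; split => // im; rewrite im eqxx in imax.
move=> /choice[x0 x0P]; pose x i : torus R := fun n => x0 (i, n).
pose M := (m * q)%N; have M0 : (0 < M)%N by rewrite muln_gt0 m0.
pose y i : torus R := fun n => x i n + (if n == (N + i)%N then circle_root M else 0).
have xqn i n : x i n *+ q = 0 by have [] := x0P (i, n).
have xq i : x i *+ q = 0 by apply/funext => n; rewrite torusMn xqn.
have yM i : y i *+ M = 0.
  apply/funext => n; rewrite torusMn mulrnDl {1}/M mulnC mulrnA xqn mul0rn add0r.
  by case: ifP => _; rewrite ?circle_root_torsion// mul0rn.
pose comb (c : 'I_k.+1 -> nat) : torus R := \sum_i y i *+ c i.
(* Coefficients below [M] give all combinations, since [M] kills every [y i]; so [L0] is finite,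
   hence closed. *)
pose L0 := range (fun c : {ffun 'I_k.+1 -> 'I_M} => comb (fun i => c i : nat)).
have L0comb c : L0 (comb c).
  exists [ffun i => Ordinal (ltn_pmod (c i) M0)] => //.
  by apply: eq_bigr => i _; rewrite ffunE /= mulrn_modn.
have L0y i : L0 (y i).
  have <- : comb (fun j => (j == i : nat)) = y i; last exact: L0comb.
  rewrite /comb (bigD1 i)//= eqxx mulr1n big1 ?addr0// => j /negPf ->.
  by rewrite mulr0n.
have L0z : zmod_closed (mem L0).
  split; first by rewrite inE (_ : 0 = comb (fun=> 0%N)) // /comb big1.
  move=> u v; rewrite !inE => -[c _ <-] [c' _ <-].
  (* Modulo [M], the natural number [M - c' i] stands for the negative of [c' i]. *)
  rewrite (_ : _ - _ = comb (fun i => (c i + (M - c' i))%N))//.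
  rewrite /comb -sumrB; apply: eq_bigr => i _.
  by rewrite mulrnDr mulrnBr 1?ltnW// yM sub0r.
have L0c : closed L0.
  apply: (accessible_finite_set_closed.1 (hausdorff_accessible (@metric_hausdorff _ _))).
  exact: finite_image.
pose L : torus_subgroups R := @ClosedSubgroup (torus R) (Subgroup L0z) L0c.
exists N, k, q, x, L; split => //.
- exact: leq_maxl.
- apply: (@le_lt_trans _ _ (e / 2)); last by rewrite gtr_pMr// invf_lt1// ltr1n.
  have sum4 : e / 4 + e / 4 = e / 2 by field.
  have yN i n : (n < N)%N -> y i n = x i n.
    by move=> nN; rewrite /y ltn_eqF ?addr0// ltn_addr.
  apply: hausdorff_dist_le; [exact: subgroup_nonempty..| |].
    move=> z Kz; have [j jP] := a0P z Kz; pose i : 'I_k.+1 := lift ord_max j.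
    have Lyi : (L : set _) (y i).
      exact: L0y.
    apply: le_trans (dist_to_set_le z Lyi) _.
    apply: (@le_trans _ _ (e / 4 + 2^-1 ^+ N)); last by rewrite -sum4 lerD2l ltW.
    apply: torus_dist_trunc => [|n nN]; first by rewrite divr_ge0 ?ltW.
    rewrite yN// -[z n](subrK (a i n)) -addrA (le_trans (circle_normD _ _))//.
    rewrite (_ : e / 4 = e / 8 + e / 8); last by field.
    apply: lerD; first by rewrite /a /i liftK jP.
    have [_ /(_ nN) h _ _] := x0P (i, n).
    rewrite (le_trans (_ : _ <= circle_norm (a i n - x i n) *+ q))//.
      by rewrite -[leLHS]mulr1n; apply: ler_wpMn2l => //; exact: circle_norm_ge0.
    exact: le_trans (ltW h) dle.
  move=> _ [c _ <-].
  (* Below [N], [y i] coincides with [x i], which [q] kills. Reducing the coefficients modulo [q] is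
     needed because the bound on [a i - x i] covers only its multiples up to [q]. *)
  pose w : torus R := \sum_i a i *+ (c i %% q).
  have Kw : (K : set _) w.
    rewrite /w; elim/big_ind: _ => [|u v|]; first exact: subgroup0.
      exact: subgroupD.
    by move=> i _; exact: subgroupMn.
  apply: le_trans (dist_to_set_le _ Kw) _.
  apply: (@le_trans _ _ (e / 4 + 2^-1 ^+ N)); last by rewrite -sum4 lerD2l ltW.
  apply: torus_dist_trunc => [|n nN]; first by rewrite divr_ge0 ?ltW.
  have sumE (I : finType) (F : I -> torus R) : (\sum_i F i) n = \sum_i F i n.
    by rewrite (big_morph (fun u : torus R => u n) (id1 := 0) (op1 := +%R)).
  rewrite /comb /w !sumE -sumrB; apply: (@le_trans _ _ (e / 8)); last first.
    by rewrite ler_pM2l// lef_pV2 ?posrE// ler_nat.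
  rewrite -dk -[k.+1 in leRHS]card_ord -sumr_const.
  elim/big_ind2: _ => [|r1 s1 r2 s2 h1 h2|i _]; first by rewrite circle_norm0.
    by rewrite (le_trans (circle_normD _ _))// lerD.
  rewrite !torusMn yN// -circle_normN opprB.
  rewrite -(mulrn_modn (c i) (xqn i n)) -mulrnBl.
  have [_ /(_ nN) h _ _] := x0P (i, n).
  rewrite (le_trans (circle_normMn _ _))// (le_trans _ (ltW h))//.
  by apply: ler_wpMn2l; [exact: circle_norm_ge0|rewrite ltnW// ltn_mod].
- split => // [i n nN|]; first by have [_ _ h _] := x0P (i, n); exact: h.
  by apply/funext => n; have [_ _ _ h] := x0P (ord_max, n); exact: h.
- move=> P; split => [LP i|yP _ [c _ <-]].
    exact/LP/L0y.
  rewrite raddf_sum big1// => i _.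
  by rewrite raddfMn /= [X in X *+ _]yP mul0rn.
Qed.

End Density.

(** * The generic conditions and their density *)

Section Generic.
Context {R : realType}.
Implicit Types (x y z : torus R) (P Q : {poly int}) (K L : torus_subgroups R).

Lemma eq_torus_char P x y : (forall n, (n < size P)%N -> x n = y n) ->
  torus_char P x = torus_char P y.
Proof. by move=> xy; apply: eq_bigr => i _; rewrite xy. Qed.

Lemma torus_char_suml (I : finType) (F : I -> {poly int}) x :
  torus_char (\sum_i F i) x = \sum_i torus_char (F i) x.
Proof.
apply: (big_morph (fun P => torus_char P x)) => [P Q|].
  exact: torus_charD.
exact: torus_char0l.
Qed.

(** The complements of the [U i] are closed with empty interior; the empty set fills the numbers
    that encode no index. *)
Lemma comeager_countable (X : topologicalType) (I : countType)
    (U : I -> set X) (A : set X) :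
  (forall i, open (U i)) -> (forall i, dense (U i)) ->
  \bigcap_i U i `<=` A -> comeager A.
Proof.
move=> Uo Ud UA.
exists (fun n => if unpickle n is Some i then ~` U i else set0).
  move=> n; rewrite /nowhere_dense; case: (unpickle n) => [i|]; last first.
    by rewrite closure0 interior0.
  have <- : ~` U i = closure (~` U i) by apply/closure_id; exact: open_closedC.
  apply/seteqP; split => // x Ux.
  have [|y [/interior_subset]] := Ud i _ _ (@open_interior _ (~` U i)) => //.
  by exists x.
move=> x Ax; apply: contrapT => h; apply: Ax; apply: UA => i _.
by apply: contrapT => Ui; apply: h; exists (pickle i) => //; rewrite pickleK.
Qed.

Lemma dense_torus_subgroups (U : set (torus_subgroups R)) :
  (forall K (e : R), 0 < e -> exists2 L, mdist K L < e & U L) -> dense U.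
Proof.
move=> h O [K OK] Oo; have /nbhs_ballP[e /= e0 eO] : nbhs K O by exact: open_nbhs_nbhs.
have [L KL UL] := h K e e0; exists L; split => //.
by apply: eO; rewrite ballEmdist.
Qed.

Definition torsion_generic P : set (torus_subgroups R) :=
  \bigcup_m [set K : torus_subgroups R | annihilates K (P *+ m.+1)].

Definition divisible_generic P m : set (torus_subgroups R) :=
  \bigcup_Q [set K : torus_subgroups R | annihilates K (Q *+ m - P)].

(** Required for every list [s], this makes the [p]-torsion of the dual infinite, which for prime
    [p] means infinite [p]-rank. *)
Definition rank_generic p (s : seq {poly int}) : set (torus_subgroups R) :=
  \bigcup_P ([set K : torus_subgroups R | annihilates K (P *+ p)] `&`
    \big[setI/setT]_(Q <- s) [set K : torus_subgroups R | ~ annihilates K (P - Q)]).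

Lemma torsion_generic_open P : open (torsion_generic P).
Proof. by apply: bigcup_open => m _; exact: open_annihilates. Qed.

Lemma divisible_generic_open P m : open (divisible_generic P m).
Proof. by apply: bigcup_open => Q _; exact: open_annihilates. Qed.

Lemma rank_generic_open p s : open (rank_generic p s).
Proof.
apply: bigcup_open => P _; apply: openI; first exact: open_annihilates.
apply: big_ind => [|A B|Q _]; [exact: openT|exact: openI|].
exact: open_not_annihilates.
Qed.

Lemma torsion_generic_dense P : dense (torsion_generic P).
Proof.
apply: dense_torus_subgroups => K e e0.
have [N [k [q [x [L /= [_ q0 KL [_ yq _ _] LP]]]]]] :=
  torsion_approx K 0 e0 (ltn0Sn 0).
(* The predecessor, because [torsion_generic] multiplies by [m.+1]. *)
exists L => //; exists q.-1 => //=; apply/LP => i.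
rewrite prednK// torus_charMnl -raddfMn /= (_ : _ *+ q = 0) ?raddf0//.
by have := yq i; rewrite mul1n.
Qed.

(** On the generator [y i], [P] takes the value [circle_root q *+ a i], since it only sees
    coordinates below [N], while the coordinate [N + i] takes the value [circle_root (m * q)]. The
    coordinates [N + j] with exponents [a j] thus form an [m]-th part of [P] on [L]. *)
Lemma divisible_generic_dense P m : (0 < m)%N -> dense (divisible_generic P m).
Proof.
move=> m0; apply: dense_torus_subgroups => K e e0.
have [N [k [q [x [L /= [PN q0 KL [xq yq xN _] LP]]]]]] :=
  torsion_approx K (size P) e0 m0.
exists L => //.
have : forall i, exists a, torus_char P (x i) = circle_root q *+ a.
  move=> i; apply: torsion_circle_root => //.
  by rewrite -raddfMn /= xq raddf0.
move=> /choice[a aP].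
exists (\sum_(j < k.+1) 'X^(N + j) *+ a j) => //=; apply/LP => i.
rewrite torus_charBl torus_charMnl torus_char_suml (bigD1 i)//= big1 ?addr0.
  rewrite torus_charMnl torus_charXn xN ?leq_addr// add0r eqxx -mulrnAC.
  rewrite mulnC circle_rootM// -aP; apply/eqP; rewrite subr_eq0; apply/eqP.
  apply: eq_torus_char => n nP; rewrite ltn_eqF ?addr0//.
  by rewrite (leq_trans nP)// (leq_trans PN)// leq_addr.
move=> j ji; rewrite torus_charMnl torus_charXn xN ?leq_addr// add0r.
by rewrite eqn_add2l ifN ?mul0rn.
Qed.

(** The witness is [q] times the coordinate [N + k]. Its value on the last generator is
    [circle_root p], whereas every [Q] in [s] vanishes there, as that generator is zero below
    [N]. *)
Lemma rank_generic_dense p s : (1 < p)%N -> dense (rank_generic p s).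
Proof.
move=> p1; have p0 : (0 < p)%N by exact: ltnW.
apply: dense_torus_subgroups => K e e0.
have [N [k [q [x [L /= [sN q0 KL [xq yq xN x0] LP]]]]]] :=
  torsion_approx K (\max_(Q <- s) size Q) e0 p0.
exists L => //; exists ('X^(N + k) *+ q) => //; split => /=.
  apply/LP => i; rewrite -mulrnA torus_charMnl torus_charXn xN ?leq_addr// add0r.
  by case: ifP => _; rewrite ?mul0rn// mulnC circle_root_torsion// muln_gt0 p0 q0.
rewrite -bigcap_seq => Q /= Qs /LP/(_ ord_max).
rewrite torus_charBl torus_charMnl torus_charXn x0 add0r eqxx circle_rootM//.
rewrite (_ : torus_char Q _ = torus_char Q 0) ?raddf0.
  rewrite ?oppr0 addr0 -[circle_root p]mulr1n => /(circle_root_eq0 1%N p0).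
  by rewrite dvdn1 gtn_eqF.
rewrite -[RHS](raddf0 (torus_char Q)); apply: eq_torus_char => n nQ.
rewrite add0r ltn_eqF//.
rewrite (leq_trans nQ)// (leq_trans _ (leq_addr _ _))// (leq_trans _ sN)//.
exact: leq_bigmax_seq.
Qed.

Lemma comeager_generic (A : set (torus_subgroups R)) :
  (forall K, (forall P, torsion_generic P K) ->
     (forall P m, (0 < m)%N -> divisible_generic P m K) ->
     (forall p s, (1 < p)%N -> rank_generic p s K) -> A K) -> comeager A.
Proof.
(* The shifts [m.+1] and [p.+2] build in the conditions [0 < m] and [1 < p] of the density
   lemmas. *)
move=> h; pose U (i : {poly int} + ({poly int} * nat + nat * seq {poly int})) :=
  match i with
  | inl P => torsion_generic P
  | inr (inl (P, m)) => divisible_generic P m.+1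
  | inr (inr (p, s)) => rank_generic p.+2 s
  end.
apply: (@comeager_countable _ _ U) => [[P|[[P m]|[p s]]]|[P|[[P m]|[p s]]]|K UK] /=.
- exact: torsion_generic_open.
- exact: divisible_generic_open.
- exact: rank_generic_open.
- exact: torsion_generic_dense.
- exact: divisible_generic_dense.
- exact: rank_generic_dense.
- apply: h => [P|P [//|m] _|[|[|p]]// s _].
  + exact: (UK (inl P)).
  + exact: (UK (inr (inl (P, m)))).
  + exact: (UK (inr (inr (p, s)))).
Qed.

End Generic.

Lemma coprime_inverse (k m : nat) : (0 < m)%N -> coprime k m ->
  exists u, (u * k = 1 %[mod m])%N.
Proof.
move=> m0 km; have [k0|k0] := posnP k.
  by move: km; rewrite k0 /coprime gcd0n => /eqP ->; exists 0%N; rewrite !modn1.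
case: (egcdnP m k0) => u v uv _; exists u.
by rewrite uv (eqP km) modnMDl.
Qed.

(** * Bases of the socles and Prüfer towers *)

Section Recognition.
(** Elements of [G] stand for characters of [X]. Distinct elements may induce the same character, so
    characters are always compared pointwise. *)
Context {R : realType} (X G : zmodType) (ev : G -> X -> circle R) (enum : nat -> G).
Hypotheses (enum_surj : forall P, exists n, enum n = P)
  (evDl : forall P Q x, ev (P + Q) x = ev P x + ev Q x)
  (evDr : forall P x y, ev P (x + y) = ev P x + ev P y)
  (ev_torsion : forall P, exists2 m, (0 < m)%N & forall x, ev P x *+ m = 0)
  (ev_div : forall P m, (0 < m)%N -> exists Q, forall x, ev Q x *+ m = ev P x)
  (ev_rank : forall p (s : seq G), (1 < p)%N -> exists P,
     (forall x, ev P x *+ p = 0) /\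
     forall Q, Q \in s -> ~ forall x, ev P x = ev Q x).

Local Notation primes := {p : nat | prime p}.
Implicit Types (P Q : G) (x y : X) (p : nat) (q : primes).

Let ev0l x : ev 0 x = 0.
Proof. by apply: (addIr (ev 0 x)); rewrite -evDl !add0r. Qed.

Let evBl P Q x : ev (P - Q) x = ev P x - ev Q x.
Proof. by apply: (addIr (ev Q x)); rewrite -evDl !subrK. Qed.

Let evMnl P n x : ev (P *+ n) x = ev P x *+ n.
Proof. by elim: n => [|n IH]; rewrite ?mulr0n ?ev0l// !mulrS evDl IH. Qed.

Let ev0r P : ev P 0 = 0.
Proof. by apply: (addIr (ev P 0)); rewrite -evDr !add0r. Qed.

Let evBr P x y : ev P (x - y) = ev P x - ev P y.
Proof. by apply: (addIr (ev P y)); rewrite -evDr !subrK. Qed.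

Let evMnr P n x : ev P (x *+ n) = ev P x *+ n.
Proof. by elim: n => [|n IH]; rewrite ?mulr0n ?ev0r// !mulrS evDr IH. Qed.

Let ev_sumr P (I : Type) (s : seq I) (F : I -> X) :
  ev P (\sum_(i <- s) F i) = \sum_(i <- s) ev P (F i).
Proof. by elim: s => [|i s IH]; rewrite ?big_nil ?big_cons ?ev0r// evDr IH. Qed.

(* Coefficients below [p] are enough for characters killed by [p], and keep the
   list finite, as needed to apply [ev_rank]. *)
Fixpoint combinations p (s : seq G) : seq G :=
  if s is P :: s' then
    [seq P *+ c + Q | c <- iota 0 p, Q <- combinations p s']
  else [:: 0].

Let mem_combinations p P s c Q : (c < p)%N -> Q \in combinations p s ->
  P *+ c + Q \in combinations p (P :: s).
Proof. by move=> cp Qs; apply/allpairsP; exists (c, Q); split; rewrite ?mem_iota. Qed.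

Let combinations0 p s : (0 < p)%N -> 0 \in combinations p s.
Proof.
move=> p0; elim: s => [|P s IH]; first by rewrite mem_seq1.
by have := mem_combinations P p0 IH; rewrite mulr0n add0r.
Qed.

(* The last clause makes the basis spanning: the character number [size s] is
   dealt with when the basis has [size s] elements. *)
Let extend_basis p s : (1 < p)%N -> exists P,
  [/\ forall x, ev P x *+ p = 0,
      forall Q, Q \in combinations p s -> ~ forall x, ev P x = ev Q x
    & (forall x, ev (enum (size s)) x *+ p = 0) ->
      exists2 Q, Q \in combinations p (P :: s) &
        forall x, ev (enum (size s)) x = ev Q x].
Proof.
move=> p1; have p0 : (0 < p)%N by exact: ltnW.
set P0 := enum _.
have [[P0p P0s]|h] := pselect ((forall x, ev P0 x *+ p = 0) /\
    forall Q, Q \in combinations p s -> ~ forall x, ev P0 x = ev Q x).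
  exists P0; split => // _; exists (P0 *+ 1 + 0); last by rewrite mulr1n addr0.
  by apply: mem_combinations => //; exact: combinations0.
have [P [Pp Ps]] := ev_rank (combinations p s) p1.
exists P; split => // P0p; apply: contrapT => h'; apply: h; split => // Q Qs P0Q.
apply: h'; exists (P *+ 0 + Q); last by rewrite mulr0n add0r.
exact: mem_combinations.
Qed.

(** Natural coefficients suffice for torsion characters. Only the terms below [i] occur, so
    independence can be stated as each term not being a combination of the earlier ones. *)
Definition lincomb (sigma : nat -> G) i (f : X -> circle R) :=
  exists c : nat -> nat, forall x, f x = \sum_(j < i) ev (sigma j) x *+ c j.

(** The extension step is iterated on the list of all earlier elements. Stage [i] puts the character
    number [i], if killed by [p], into the span of the first [i.+1] elements. *)
Let socle_basis p : (1 < p)%N -> exists sigma : nat -> G,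
  [/\ forall i x, ev (sigma i) x *+ p = 0,
      forall i, ~ lincomb sigma i (ev (sigma i))
    & forall P, (forall x, ev P x *+ p = 0) -> exists i, lincomb sigma i (ev P)].
Proof.
move=> p1; have p0 : (0 < p)%N by exact: ltnW.
have [pick pickP] := choice (fun s => @extend_basis p s p1).
pose hist := fix hist i := if i is j.+1 then pick (hist j) :: hist j else [::].
have size_hist i : size (hist i) = i by elim: i => //= i ->.
pose sigma i := pick (hist i).
have sigmap i x : ev (sigma i) x *+ p = 0 by have [] := pickP (hist i).
exists sigma; split => // [i [c ic]|P Pp].
  (* Reducing the coefficients modulo [p] brings the combination into the finite list that the new
     element avoids. *)
  have [Q Qi QE] : exists2 Q, Q \in combinations p (hist i) &
      forall x, ev Q x = \sum_(j < i) ev (sigma j) x *+ c j.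
    elim: (i) => [|k [Q Qk QE]].
      by exists 0 => [|x]; rewrite ?mem_seq1// big_ord0 ev0l.
    exists (sigma k *+ (c k %% p) + Q) => [|x].
      by apply: mem_combinations => //; rewrite ltn_mod.
    by rewrite big_ord_recr/= evDl evMnl QE addrC mulrn_modn.
  have [_ + _] := pickP (hist i); move/(_ Q Qi); apply => x.
  by rewrite QE -ic.
have [i iP] := enum_surj P.
have [_ _] := pickP (hist i); rewrite size_hist iP => /(_ Pp)[Q Qi PQ].
exists i.+1; have {Qi} : Q \in combinations p (hist i.+1) by [].
elim: i.+1 Q (ev P) PQ => [|k IH] Q f fQ.
  rewrite mem_seq1 => /eqP Q0; exists (fun=> 0%N) => x.
  by rewrite big_ord0 fQ Q0 ev0l.
move=> /allpairsP[[d Q'] /= [_ Q'k QE]].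
have [c cP] := IH Q' _ (fun=> erefl) Q'k.
exists (fun j => if j == k then d else c j) => x.
rewrite fQ QE evDl evMnl cP big_ord_recr/= eqxx addrC; congr (_ + _).
by apply: eq_bigr => j _; rewrite ltn_eqF.
Qed.

Let prime_gt1P q : (1 < val q)%N. Proof. exact: prime_gt1 (valP q). Qed.
Let prime_gt0P q : (0 < val q)%N. Proof. exact: prime_gt0 (valP q). Qed.

Let prime_coprimeX q l n : q != l -> coprime (val q) (val l ^ n).
Proof.
move=> ql; apply: coprimeXr; rewrite (prime_coprime _ (valP q)).
by rewrite (dvdn_prime2 (valP q) (valP l)) val_eqE.
Qed.

(* The towers above the socle bases give the embeddings of the Prüfer groups
   into the dual group. *)
Lemma pruefer_basis : exists phi : primes -> nat -> nat -> G,
  [/\ forall q i x, ev (phi q i 0) x *+ val q = 0,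
      forall q i n x, ev (phi q i n.+1) x *+ val q = ev (phi q i n) x,
      forall q i, ~ lincomb (fun j => phi q j 0) i (ev (phi q i 0))
    & forall q P, (forall x, ev P x *+ val q = 0) ->
        exists i, lincomb (fun j => phi q j 0) i (ev P)].
Proof.
have [sigma sigmaP] := choice (fun q => socle_basis (prime_gt1P q)).
have [div divP] := choice (fun u : G * primes => ev_div u.1 (prime_gt0P u.2)).
exists (fun q i n => iter n (fun P => div (P, q)) (sigma q i)).
split => [q i x|q i n x|q i|q P] /=; have [] := sigmaP q.
- by move=> h _ _; exact: h.
- by move=> _ _ _; exact: (divP (_, q)).
- by move=> _ h _; exact: h.
- by move=> _ _ h; exact: h.
Qed.

(** * Generation of all characters by the towers *)

Context (phi : primes -> nat -> nat -> G).
Hypotheses (phi_torsion0 : forall q i x, ev (phi q i 0) x *+ val q = 0)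
  (phi_tower : forall q i n x, ev (phi q i n.+1) x *+ val q = ev (phi q i n) x)
  (phi_free : forall q i, ~ lincomb (fun j => phi q j 0) i (ev (phi q i 0)))
  (phi_span : forall q P, (forall x, ev P x *+ val q = 0) ->
     exists i, lincomb (fun j => phi q j 0) i (ev P)).

Lemma phi_towerX q i n k x :
  ev (phi q i (n + k)) x *+ val q ^ k = ev (phi q i n) x.
Proof.
elim: k => [|k IH]; first by rewrite addn0 expn0 mulr1n.
by rewrite addnS expnS mulrnA phi_tower.
Qed.

Lemma phi_torsion q i n x : ev (phi q i n) x *+ val q ^ n.+1 = 0.
Proof. by rewrite expnSr mulrnA -[X in phi _ _ X]add0n phi_towerX phi_torsion0. Qed.

(** The subgroup generated by the towers, saturated by the last constructor under equality of the
    induced characters. *)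
Inductive phi_generated : G -> Prop :=
| phi_generated0 : phi_generated 0
| phi_generatedB P Q : phi_generated P -> phi_generated Q -> phi_generated (P - Q)
| phi_generated_phi q i n : phi_generated (phi q i n)
| phi_generated_eq P Q : phi_generated P -> (forall x, ev P x = ev Q x) ->
    phi_generated Q.

Let phi_generatedD P Q : phi_generated P -> phi_generated Q -> phi_generated (P + Q).
Proof.
move=> gP gQ; rewrite -[Q]opprK -[- Q]sub0r; apply: phi_generatedB => //.
by apply: phi_generatedB => //; exact: phi_generated0.
Qed.

Let phi_generatedMn P n : phi_generated P -> phi_generated (P *+ n).
Proof.
move=> gP; elim: n => [|n IH]; first exact: phi_generated0.
by rewrite mulrS; exact: phi_generatedD.
Qed.

Let phi_generated_socle q P : (forall x, ev P x *+ val q = 0) -> phi_generated P.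
Proof.
move=> /phi_span[i [c cP]].
apply: (@phi_generated_eq (\sum_(j < i) phi q j 0 *+ c j)).
  elim/big_ind: _ => [|P1 P2|j _]; [exact: phi_generated0|exact: phi_generatedD|].
  by apply: phi_generatedMn; exact: phi_generated_phi.
move=> x; rewrite cP; elim: (i) => [|k IH]; first by rewrite !big_ord0 ev0l.
by rewrite !big_ord_recr/= evDl evMnl IH.
Qed.

(** Division by [q] is one step up in a tower for [q] itself. In a tower for another prime [l], [q]
    is invertible modulo the power of [l] killing the character. *)
Let phi_generated_div q P : phi_generated P ->
  exists2 Q, phi_generated Q & forall x, ev Q x *+ val q = ev P x.
Proof.
elim=> [|P1 P2 _ [Q1 g1 Q1P] _ [Q2 g2 Q2P]|l i n|P1 P2 _ [Q1 g1 Q1P] P12].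
- by exists 0 => [|x]; [exact: phi_generated0|rewrite ev0l mul0rn].
- exists (Q1 - Q2) => [|x]; first exact: phi_generatedB.
  by rewrite !evBl mulrnBl Q1P Q2P.
- have [->|ql] := eqVneq q l.
    by exists (phi l i n.+1) => // ; exact: phi_generated_phi.
  have [|u uq] := coprime_inverse _ (prime_coprimeX n.+1 ql).
    by rewrite expn_gt0 prime_gt0P.
  exists (phi l i n *+ u) => [|x]; first exact/phi_generatedMn/phi_generated_phi.
  rewrite evMnl -mulrnA -(mulrn_modn _ (phi_torsion l i n x)) uq.
  by rewrite mulrn_modn ?mulr1n ?phi_torsion.
- by exists Q1 => // x; rewrite Q1P P12.
Qed.

(* The span of the towers is divisible and contains every character of prime
   order, so it absorbs a torsion character prime by prime. *)
Lemma phi_generated_all P : phi_generated P.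
Proof.
have [m m0 Pm] := ev_torsion P; elim/ltn_ind: m P m0 Pm => m IH P m0 Pm.
have [m1|m1] := leqP m 1.
  apply: (phi_generated_eq phi_generated0) => x.
  by rewrite ev0l -(Pm x) (_ : m = 1%N) ?mulr1n//; apply/eqP; rewrite eqn_leq m1.
have pr := pdiv_prime m1; pose q : primes := exist _ (pdiv m) pr.
have mE : m = (pdiv m * (m %/ pdiv m))%N by rewrite mulnC divnK// pdiv_dvd.
(* The multiple [P *+ val q] is killed by the smaller number [m %/ pdiv m]. Dividing it by [q]
   inside the span gives [Q] with [P - Q] killed by [q]. *)
have [Q gQ QP] : exists2 Q, phi_generated Q &
    forall x, ev Q x *+ val q = ev (P *+ val q) x.
  apply: phi_generated_div; apply: (IH (m %/ pdiv m)%N) => [||x].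
  - by rewrite ltn_Pdiv// prime_gt1.
  - by rewrite divn_gt0 ?prime_gt0// pdiv_leq.
  - by rewrite evMnl -mulrnA -mE.
rewrite -(subrK Q P); apply: phi_generatedD => //.
apply: (@phi_generated_socle q) => x.
by rewrite evBl mulrnBl QP evMnl subrr.
Qed.

Let lincomb_sum sigma i (I : eqType) (s : seq I) (g : I -> X -> circle R) :
  (forall a, a \in s -> lincomb sigma i (g a)) ->
  lincomb sigma i (fun x => \sum_(a <- s) g a x).
Proof.
elim: s => [|a s IH] gs.
  by exists (fun=> 0%N) => x; rewrite big_nil big1// => j _; rewrite mulr0n.
have [c cP] := gs a (mem_head _ _).
have [d dP] := IH (fun b bs => gs b (@mem_behead _ (a :: s) b bs)).
exists (fun j => c j + d j)%N => x; rewrite big_cons cP dP -big_split.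
by apply: eq_bigr => j _ /=; rewrite mulrnDr.
Qed.

Let mulrn_coprime_eq0 (c : circle R) k m : (0 < m)%N -> coprime k m ->
  c *+ k = 0 -> c *+ m = 0 -> c = 0.
Proof.
move=> m0 /(coprime_inverse m0)[u uk] ck cm; rewrite -[c]mulr1n.
have : c *+ (u * k) = 0 by rewrite mulnC mulrnA ck mul0rn.
by rewrite -(mulrn_modn _ cm) uk mulrn_modn.
Qed.

(** * Dual systems of points *)

Definition dual_system n (s : seq (primes * nat)) (e : primes * nat -> X) :=
  forall a b, a \in s -> b \in s -> ev (phi a.1 a.2 n) (e b) =
    if a == b then @circle_root R (val a.1 ^ n.+1) else 0.

Let dual_coord n s e (k : primes * nat -> nat) b : uniq s ->
  dual_system n s e -> b \in s ->
  ev (phi b.1 b.2 n) (\sum_(a <- s) e a *+ k a) =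
  @circle_root R (val b.1 ^ n.+1) *+ k b.
Proof.
move=> us ds bs; rewrite ev_sumr (bigD1_seq b)//= evMnr ds// eqxx.
rewrite big_seq_cond big1 ?addr0// => a /andP[as_ ab].
by rewrite evMnr ds// eq_sym (negPf ab) mul0rn.
Qed.

(** Otherwise [phi q i 0] would vanish wherever the level [n] characters of [s] do. Expanding points
    along the dual system would then make it a combination of the [phi q j 0] with [j < i], against
    freeness. *)
Let dual_system_extend n s e q i : uniq s -> dual_system n s e ->
  (forall j, (q, j) \in s -> (j < i)%N) ->
  exists2 h, forall a, a \in s -> ev (phi a.1 a.2 n) h = 0 &
    ev (phi q i 0) h <> 0.
Proof.
move=> us ds sq; apply: contrapT => hN.
have H0 h : (forall a, a \in s -> ev (phi a.1 a.2 n) h = 0) -> ev (phi q i 0) h = 0.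
  by move=> hs; apply: contrapT => qh; apply: hN; exists h.
have : forall u : (primes * nat) * X, exists k,
    ev (phi u.1.1 u.1.2 n) u.2 = @circle_root R (val u.1.1 ^ n.+1) *+ k.
  move=> [a x] /=; apply: torsion_circle_root; last exact: phi_torsion.
  by rewrite expn_gt0 prime_gt0P.
move=> /choice[k kP].
(* Subtracting from [x] its expansion along the points [e a] leaves a point killed by all characters
   of [s]. *)
have qE x : ev (phi q i 0) x = \sum_(a <- s) ev (phi q i 0) (e a) *+ k (a, x).
  apply/eqP; rewrite -subr_eq0; apply/eqP.
  under eq_bigr do rewrite -evMnr.
  rewrite -ev_sumr -evBr; apply: H0 => a as_.
  by rewrite evBr dual_coord// -(kP (a, x)) subrr.
apply: (@phi_free q i); rewrite (_ : ev _ = fun x => \sum_(a <- s)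
    ev (phi q i 0) (e a) *+ k (a, x)); last exact/funext.
apply: lincomb_sum => -[l j] ljs.
have l0 : (0 < val l ^ n.+1)%N by rewrite expn_gt0 prime_gt0P.
(* For [l] different from [q] the coefficient vanishes, being killed both by [q] and by
   [val l ^ n.+1]; the latter holds because that multiple of [e (l, j)] is killed by the characters
   of [s]. *)
have [lq|lq] := eqVneq l q; last first.
  exists (fun=> 0%N) => x; rewrite [RHS]big1 => [|j' _]; last by rewrite mulr0n.
  rewrite (@mulrn_coprime_eq0 (ev (phi q i 0) (e (l, j))) (val q)
    (val l ^ n.+1)) ?mul0rn//.
    by apply: prime_coprimeX; rewrite eq_sym.
  rewrite -evMnr; apply: H0 => a as_; rewrite evMnr ds//.
  case: eqP => [->|_]; last by rewrite mul0rn.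
  by rewrite circle_root_torsion.
subst l; have ji := sq _ ljs.
have [b bP] : exists b, ev (phi q i 0) (e (q, j)) = @circle_root R (val q) *+ b.
  exact: torsion_circle_root.
exists (fun j' => if j' == j then b else 0%N) => x.
rewrite (bigD1 (Ordinal ji))//= eqxx big1 ?addr0 => [|j' /eqP j'j]; last first.
  by case: eqP => [j'E|_]; rewrite ?mulr0n//; case: j'j; apply: val_inj.
rewrite bP -mulrnA mulnC mulrnA; congr (_ *+ _).
(* Multiplying the level [n] value by [val q ^ n] turns [k (q, j, x)] into the coefficient of
   [phi q j 0] at [x]. *)
rewrite -(phi_towerX q j 0 n) add0n (kP (q, j, x)) /= -mulrnA mulnC mulrnA.
by rewrite expnS circle_rootM// expn_gt0 prime_gt0P.
Qed.

Let descending (a b : primes * nat) := (a.1 == b.1) ==> (b.2 < a.2)%N.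

Let descending_uniq s : pairwise descending s -> uniq s.
Proof.
elim: s => //= a s IH /andP[/allP as_ /IH ->]; rewrite andbT.
by apply/negP => /as_; rewrite /descending eqxx ltnn.
Qed.

(* [h] is killed by the characters already treated, and [phi q i 0], the
   character of order [q] below [phi q i n], does not vanish at [h]; hence a
   multiple of [h] is dual to [phi q i n]. *)
Let dual_system_exists n s : pairwise descending s -> exists e, dual_system n s e.
Proof.
elim: s => [_|[q i] s IH /=]; first by exists (fun=> 0).
move=> /andP[/allP desc ps]; have us := descending_uniq ps.
have [e ds] := IH ps; set t := (q, i).
have sq j : (q, j) \in s -> (j < i)%N by move/desc; rewrite /descending/= eqxx.
have ts : t \notin s by apply/negP => /sq; rewrite ltnn.
have [h hs hq] := dual_system_extend us ds sq.
set M := (val q ^ n.+1)%N.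
have M0 : (0 < M)%N by rewrite expn_gt0 prime_gt0P.
have [k kE] := torsion_circle_root M0 (phi_torsion q i n h).
have kM : coprime k M.
  rewrite coprime_sym coprimeXl// (prime_coprime _ (valP q)).
  apply/negP => /dvdnP[d dk]; apply: hq.
  rewrite -(phi_towerX q i 0 n) add0n kE dk -mulrnA -mulnA -expnS mulnC mulrnA.
  by rewrite circle_root_torsion// mul0rn.
have [u uk] := coprime_inverse M0 kM.
have rootM : @circle_root R M *+ M = 0 by exact: circle_root_torsion.
have ht : ev (phi q i n) (h *+ u) = @circle_root R M.
  by rewrite evMnr kE -mulrnA mulnC -(mulrn_modn _ rootM) uk mulrn_modn ?mulr1n.
have : forall a, exists k, ev (phi q i n) (e a) = @circle_root R M *+ k.
  by move=> a; exact: torsion_circle_root (phi_torsion _ _ _ _).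
move=> /choice[r rP].
(* Multiples of the new point are subtracted from the old ones so that [phi q i n] kills them; the
   values of the old characters do not change, since they kill [h]. *)
exists (fun a => if a == t then h *+ u else e a - (h *+ u) *+ r a).
move=> a b; rewrite !inE -/t => /predU1P[->|as_] /predU1P[->|bs].
- by rewrite eqxx ht.
- rewrite [t == b]eq_sym; have -> : (b == t) = false by apply: contraNF ts => /eqP <-.
  by rewrite evBr evMnr ht rP subrr.
- rewrite eqxx; have -> : (a == t) = false by apply: contraNF ts => /eqP <-.
  by rewrite evMnr hs// mul0rn.
- have -> : (b == t) = false by apply: contraNF ts => /eqP <-.
  by rewrite evBr !evMnr hs// !mul0rn subr0 ds.
Qed.

(* Decreasing second indices, so that [dual_system_exists] treats [phi q i]
   after all the [phi q j] with [j < i]. *)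
Let box n : seq (primes * nat) :=
  flatten [seq [seq (q, i) | q <- undup (pmap insub (iota 0 n))]
          | i <- rev (iota 0 n)].

Let mem_box n q i : (val q < n)%N -> (i < n)%N -> (q, i) \in box n.
Proof.
move=> qn im; apply/flattenP.
exists [seq (q, i) | q <- undup (pmap insub (iota 0 n))].
  by apply: map_f; rewrite mem_rev mem_iota.
apply: map_f; rewrite mem_undup mem_pmap_sub; rewrite mem_iota//.
Qed.

Let box_descending n : pairwise descending (box n).
Proof.
rewrite /box; have := undup_uniq (pmap insub (iota 0 n) : seq primes).
move: (undup _) => ps psu.
elim: n => [//|n IH]; rewrite -addn1 iotaD rev_cat/= pairwise_cat IH andbT.
apply/andP; split.
  apply/allrelP => -[q i] [l j] /mapP[_ _ [_ ->]] /flattenP[_ /mapP[k + ->]].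
  rewrite mem_rev mem_iota /= => kn /mapP[_ _ [_ ->]].
  by rewrite /descending /= kn implybT.
rewrite pairwise_map; elim: ps psu {IH} => //= q ps IHps /andP[qps /IHps ->].
rewrite andbT; apply/allP => l lps; rewrite /descending /=.
by apply/implyP => /eqP ql; rewrite ql lps in qps.
Qed.

Lemma characters_prescribed n (v : primes -> nat -> circle R) :
  (forall q i, v q i *+ val q ^ n.+1 = 0) -> exists x, forall q i,
    (val q < n)%N -> (i < n)%N -> ev (phi q i n) x = v q i.
Proof.
move=> vP; have [e ds] := dual_system_exists n (box_descending n).
have : forall a : primes * nat, exists k,
    v a.1 a.2 = @circle_root R (val a.1 ^ n.+1) *+ k.
  move=> [q i] /=; apply: torsion_circle_root => //.
  by rewrite expn_gt0 prime_gt0P.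
move=> /choice[k kP].
exists (\sum_(a <- box n) e a *+ k a) => q i qn im.
rewrite (@dual_coord n (box n) e k (q, i)) ?mem_box//; first by rewrite -kP.
exact/descending_uniq/box_descending.
Qed.

(** * Passage to the limit by compactness *)

(** Compactness in algebraic form: a cluster point of [u] takes every value at which a character is
    eventually constant along [u]. *)
Hypothesis ev_compact : forall u : nat -> X, exists x, forall P c,
  (exists N, forall n, (N <= n)%N -> ev P (u n) = c) -> ev P x = c.

Lemma towers_realized (t : primes -> nat -> nat -> circle R) :
  (forall q i, t q i 0%N *+ val q = 0) ->
  (forall q i n, t q i n.+1 *+ val q = t q i n) ->
  exists x, forall q i n, ev (phi q i n) x = t q i n.
Proof.
move=> t0 tS.
have tX q i n k : t q i (n + k)%N *+ val q ^ k = t q i n.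
  elim: k => [|k IH]; first by rewrite addn0 expn0 mulr1n.
  by rewrite addnS expnS mulrnA tS.
have tt q i n : t q i n *+ val q ^ n.+1 = 0.
  by rewrite expnSr mulrnA -[X in t _ _ X]add0n tX t0.
have [u uP] := choice (fun n => characters_prescribed (fun q i => tt q i n)).
have [x xP] := ev_compact u; exists x => q i n; apply: xP.
(* From this index on, [u m] has the prescribed value at level [m], hence also at level [n] after
   multiplication by a power of [q]. *)
exists (maxn (maxn (val q).+1 i.+1) n) => m; rewrite !geq_max => /andP[/andP[qm im] nm].
by rewrite -(phi_towerX q i n (m - n)) subnKC// uP// -{1}(subnKC nm) tX.
Qed.

Lemma phi_separates x y :
  (forall q i n, ev (phi q i n) x = ev (phi q i n) y) ->
  forall P, ev P x = ev P y.
Proof.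
move=> xy P.
elim: (phi_generated_all P) => [|P1 P2 _ h1 _ h2|//|P1 P2 _ h1 h12].
- by rewrite !ev0l.
- by rewrite !evBl h1 h2.
- by rewrite -!h12.
Qed.

End Recognition.

(** * Characters of the [p]-adic integers *)

Section PadicCharacters.
Context {R : realType}.

(** The embedding of Z/m onto the [m]-torsion of the circle. As ['Z_m] always has at least two
    elements, this reading requires [1 < m]. *)
Definition zmod_char (m : nat) (a : 'Z_m) : circle R := circle_root m *+ a.

Lemma zmod_char_nat m k : (1 < m)%N -> zmod_char (k%:R : 'Z_m) = circle_root m *+ k.
Proof.
by move=> m1; rewrite /zmod_char val_Zp_nat// mulrn_modn ?circle_root_torsion// ltnW.
Qed.

Lemma zmod_char_torsion m (a : 'Z_m) : (1 < m)%N -> zmod_char a *+ m = 0.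
Proof.
by move=> m1; rewrite -mulrnA mulnC mulrnA circle_root_torsion ?mul0rn// ltnW.
Qed.

Lemma zmod_char_inj m : (1 < m)%N -> injective (@zmod_char m).
Proof.
move=> m1 a b /(circle_root_inj (ltnW m1)).
rewrite -{2 4}(Zp_cast m1) !modn_small ?ltn_ord// => ab.
exact: val_inj.
Qed.

Lemma zmod_charB m (a b : 'Z_m) : (1 < m)%N ->
  zmod_char (a - b) = zmod_char a - zmod_char b.
Proof.
move=> m1; apply: (addIr (zmod_char b)); rewrite subrK -mulrnDr.
rewrite -zmod_char_nat// natrD !natr_Zp subrK//.
Qed.

Lemma zmod_char_surj m (c : circle R) : (1 < m)%N -> c *+ m = 0 ->
  exists a : 'Z_m, zmod_char a = c.
Proof.
move=> m1 /(torsion_circle_root (ltnW m1))[k ->].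
by exists k%:R; rewrite zmod_char_nat.
Qed.

Variable p : {p : nat | prime p}.

Let pX_gt1 n : (1 < val p ^ n.+1)%N.
Proof. by rewrite -{1}(exp1n n.+1) ltn_exp2r// prime_gt1// (valP p). Qed.

Definition padic_char n (z : padic_int p) : circle R :=
  @zmod_char (val p ^ n.+1) (\val z n).

Lemma padic_charB n (z w : padic_int p) :
  padic_char n (z - w) = padic_char n z - padic_char n w.
Proof. by rewrite /padic_char raddfB zmod_charB. Qed.

Let coherence n (a : 'Z_(val p ^ n.+2)) :
  zmod_char ((a : nat)%:R : 'Z_(val p ^ n.+1)) = zmod_char a *+ val p.
Proof.
rewrite zmod_char_nat// /zmod_char -mulrnA mulnC mulrnA; congr (_ *+ _).
by rewrite [(val p ^ n.+2)%N]expnSr circle_rootM// prime_gt0// (valP p).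
Qed.

Lemma padic_char_tower n z : padic_char n.+1 z *+ val p = padic_char n z.
Proof.
rewrite /padic_char -coherence; congr zmod_char.
have : padic_coherent (\val z) by have := valP z; rewrite inE.
exact.
Qed.

Lemma padic_char_torsion0 z : padic_char 0 z *+ val p = 0.
Proof. by rewrite -[in X in _ *+ X](expn1 (val p)) zmod_char_torsion. Qed.

Lemma padic_char_inj z w : (forall n, padic_char n z = padic_char n w) -> z = w.
Proof.
move=> zw; apply: val_inj; apply: functional_extensionality_dep => n.
exact: (zmod_char_inj (pX_gt1 n)) (zw n).
Qed.

(** Each [c n] is killed by [val p ^ n.+1], so it encodes a residue; injectivity of [zmod_char]
    turns the tower relation into coherence. *)
Lemma padic_char_surj (c : nat -> circle R) : c 0 *+ val p = 0 ->
  (forall n, c n.+1 *+ val p = c n) ->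
  exists z : padic_int p, forall n, padic_char n z = c n.
Proof.
move=> c0 cS; have ct n : c n *+ val p ^ n.+1 = 0.
  by elim: n => [|n IH]; rewrite ?expn1// expnS mulrnA cS.
pose d n := projT1 (cid (zmod_char_surj (pX_gt1 n) (ct n))).
have dP n : zmod_char (d n) = c n by rewrite /d; case: cid.
have dc : padic_coherent (d : padic_digits p).
  by move=> n; apply: (zmod_char_inj (pX_gt1 n)); rewrite coherence !dP.
exists (exist _ (d : padic_digits p) (mem_set dc)) => n.
exact: dP.
Qed.

Lemma continuous_padic_char n : continuous (padic_char n).
Proof.
move=> z; apply: (@continuous_comp _ _ _ (fun z : padic_int p => \val z)
  (fun w : padic_digits p => @zmod_char (val p ^ n.+1) (w n))).
  exact: initial_continuous.
apply: (@continuous_comp _ _ _ (fun w : padic_digits p => w n)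
  (fun a : discrete_topology 'Z_(val p ^ n.+1) => @zmod_char (val p ^ n.+1) a)).
  exact: (@proj_continuous nat (fun n => discrete_topology 'Z_(val p ^ n.+1)) n).
move=> A /= /nbhs_singleton Aa; apply: filterS (discrete_set1 _) => _ ->.
exact: Aa.
Qed.

End PadicCharacters.

(** * Continuity into products and into the [p]-adic integers *)

Lemma continuous_prod_topology (I : Type) (T : I -> topologicalType)
    (Y : topologicalType) (f : Y -> prod_topology T) :
  (forall i, continuous (fun y => f y i)) -> continuous f.
Proof.
move=> fc y; apply/cvg_sup => i U [_ [[W oW <-]]] /= Wy /filterS; apply.
by have := fc i y; apply; exact: open_nbhs_nbhs.
Qed.

Lemma continuous_prod_eval (I : Type) (T : I -> topologicalType) i :
  continuous (fun z : prod_topology T => z i).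
Proof.
move=> z; have /cvg_sup/(_ i) : z --> z by exact: cvg_id.
move=> h A nA; apply: h.
exact: (@initial_continuous _ _ (fun g : forall i, T i => g i) z A nA).
Qed.

Lemma continuous_funcomp (X Y Z : topologicalType) (f : X -> Y) (g : Y -> Z) :
  continuous f -> continuous g -> continuous (fun x => g (f x)).
Proof.
by move=> fc gc x; apply: (@continuous_comp _ _ _ f g); [exact: fc|exact: gc].
Qed.

Section Topology.
Context {R : realType}.

(** Distinct elements killed by [m] are at distance at least 1/m, so a continuous function with such
    values is locally constant. *)
Lemma nbhs_torsion (Y : topologicalType) (f : Y -> circle R) m y : (0 < m)%N ->
  continuous f -> (forall z, f z *+ m = 0) -> \forall z \near y, f z = f y.
Proof.
move=> m0 fc fm.
have := fc y => /metricType_numDomainType.cvgrPdist_lt/(_ m%:R^-1).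
rewrite invr_gt0 ltr0n => /(_ m0); apply: filterS => z.
rewrite circle_mdistE => yz; apply/eqP; rewrite eq_sym -subr_eq0; apply/eqP.
apply: (torsion_norm_lt m0); first by rewrite mulrnBl !fm subrr.
by rewrite -mulr_natr -ltr_pdivlMr ?ltr0n// div1r.
Qed.

Lemma continuous_to_padic (p : {p : nat | prime p}) (Y : topologicalType)
    (f : Y -> padic_int p) :
  (forall n, continuous (fun y => padic_char n (f y) : circle R)) -> continuous f.
Proof.
move=> fc; apply: continuous_comp_initial; apply: continuous_prod_topology => n y.
have p1 : (1 < val p ^ n.+1)%N.
  by rewrite -{1}(exp1n n.+1) ltn_exp2r// prime_gt1// (valP p).
have := nbhs_torsion y (ltnW p1) (fc n) (fun z => zmod_char_torsion _ p1).
move=> h A /= /nbhs_singleton Aa; apply: filterS h => z /(zmod_char_inj p1) fzy.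
exact: (@eq_ind_r _ _ A Aa _ fzy).
Qed.

Lemma continuous_prod_padics_char (p : {p : nat | prime p}) i n :
  continuous (fun z : prod_padics => padic_char n (z p i) : circle R).
Proof.
pose T q := prod_topology (fun _ : nat => padic_int q).
have cp := @continuous_prod_eval _ T p.
have cpi := continuous_funcomp cp (@continuous_prod_eval nat (fun _ => padic_int p) i).
exact: continuous_funcomp cpi (@continuous_padic_char R p n).
Qed.

End Topology.

Lemma continuous_sub (Y : topologicalType) (G : topologicalZmodType)
    (f g : Y -> G) :
  continuous f -> continuous g -> continuous (fun y => f y - g y).
Proof.
move=> fc gc y; apply: (@continuous_comp _ _ _ (fun y => (f y, g y))
  (fun z : G * G => z.1 - z.2)); last exact: sub_continuous.
by apply: cvg_pair; [exact: fc|exact: gc].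
Qed.

(** * Recognition of the product of the [p]-adic integers *)

Section PadicRecognition.
Context {R : realType} (X : topologicalZmodType) (G : zmodType)
  (ev : G -> X -> circle R) (enum : nat -> G).

(** The map [f] reads the values of a point on the towers as [p]-adic integers, and [g] realizes
    given values by compactness. The last hypothesis makes the topology of [X] initial for the
    characters, so that continuity of [g] can be tested on them. *)
Lemma isomorphic_prod_padics :
  (forall P, exists n, enum n = P) ->
  (forall P Q x, ev (P + Q) x = ev P x + ev Q x) ->
  (forall P x y, ev P (x + y) = ev P x + ev P y) ->
  (forall P, exists2 m, (0 < m)%N & forall x, ev P x *+ m = 0) ->
  (forall P m, (0 < m)%N -> exists Q, forall x, ev Q x *+ m = ev P x) ->
  (forall p (s : seq G), (1 < p)%N -> exists P,
     (forall x, ev P x *+ p = 0) /\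
     forall Q, Q \in s -> ~ forall x, ev P x = ev Q x) ->
  (forall u : nat -> X, exists x, forall P c,
     (exists N, forall n, (N <= n)%N -> ev P (u n) = c) -> ev P x = c) ->
  (forall x y, (forall P, ev P x = ev P y) -> x = y) ->
  (forall P, continuous (ev P)) ->
  (forall (Y : topologicalType) (g : Y -> X),
     (forall P, continuous (fun y => ev P (g y))) -> continuous g) ->
  topgroup_isomorphic X prod_padics.
Proof.
move=> enum_surj evDl evDr ev_tors ev_div ev_rank ev_compact ev_sep ev_cont ev_init.
have [phi [phi0 phiS phi_free phi_span]] :=
  pruefer_basis enum_surj evDl ev_div ev_rank.
have evBr P x y : ev P (x - y) = ev P x - ev P y.
  by apply: (addIr (ev P y)); rewrite -evDr !subrK.
have evBl P Q x : ev (P - Q) x = ev P x - ev Q x.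
  by apply: (addIr (ev Q x)); rewrite -evDl !subrK.
pose chi q i n (z : prod_padics) : circle R := padic_char n (z q i).
have chi_continuous q i n : continuous (chi q i n).
  exact: continuous_prod_padics_char.
have chiB q i n z w : chi q i n (z - w) = chi q i n z - chi q i n w.
  exact: padic_charB.
have chi_inj z w : (forall q i n, chi q i n z = chi q i n w) -> z = w.
  move=> zw; apply: functional_extensionality_dep => q.
  apply: functional_extensionality_dep => i.
  by apply: padic_char_inj => n; exact: zw.
have phi_inj x y : (forall q i n, ev (phi q i n) x = ev (phi q i n) y) -> x = y.
  by move=> xy; apply: ev_sep; exact: phi_separates xy.
have : forall x, exists z, forall q i n, chi q i n z = ev (phi q i n) x.
  move=> x; have ex q i : exists z : padic_int q,
      forall n, padic_char n z = ev (phi q i n) x by exact: padic_char_surj.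
  exists (fun q i => projT1 (cid (ex q i))) => q i n.
  by rewrite /chi; case: cid.
move=> /choice[f fP].
have : forall z, exists x, forall q i n, ev (phi q i n) x = chi q i n z.
  move=> z; apply: (towers_realized evDr phi0 phiS phi_free ev_compact).
    by move=> q i; exact: padic_char_torsion0.
  by move=> q i n; exact: padic_char_tower.
move=> /choice[g gP].
have fB : {morph f : x y / x - y}.
  by move=> x y; apply: chi_inj => q i n; rewrite chiB !fP evBr.
have gB : {morph g : x y / x - y}.
  by move=> x y; apply: phi_inj => q i n; rewrite evBr !gP chiB.
pose fA := GRing.isZmodMorphism.Build X prod_padics f fB.
pose gA := GRing.isZmodMorphism.Build prod_padics X g gB.
pose f' : {additive X -> prod_padics} := HB.pack f fA.
pose g' : {additive prod_padics -> X} := HB.pack g gA.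
exists f', g'; split => /=.
- by move=> x; apply: phi_inj => q i n; rewrite gP fP.
- by move=> z; apply: chi_inj => q i n; rewrite fP gP.
- apply: continuous_prod_topology => q; apply: continuous_prod_topology => i.
  apply: (@continuous_to_padic R) => n.
  by under eq_fun do rewrite -/(chi q i n _) fP; exact: ev_cont.
- apply: (@ev_init prod_padics g) => P.
  (* Continuity of a character composed with [g] is propagated along its generation by the towers,
     on which the composite is [chi q i n]. *)
  elim: (phi_generated_all evDl ev_tors phi0 phiS phi_span P) =>
      [|P1 P2 _ h1 _ h2|q i n|P1 P2 _ h1 h12].
  + rewrite (_ : (fun y => _) = cst 0); first exact: cst_continuous.
    apply/funext => y; have := evBl 0 0 (g y); rewrite !subrr => ->//.
  + rewrite (_ : (fun y => _) = (fun y => ev P1 (g y) - ev P2 (g y))).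
      exact: continuous_sub h1 h2.
    by apply/funext => y; rewrite evBl.
  + rewrite (_ : (fun y => _) = chi q i n); last by apply/funext => y; exact: gP.
    exact: chi_continuous.
  + rewrite (_ : (fun y => _) = (fun y => ev P1 (g y))) //.
    by apply/funext => y; rewrite h12.
Qed.

End PadicRecognition.

(** * Application to generic closed subgroups of the torus *)

(** The closed set where [P] equals [c] contains a tail of [u], hence every cluster point of [u]. *)
Lemma cluster_char (R : realType) (K : torus_subgroups R) (u : nat -> torus R) :
  (forall n, (K : set _) (u n)) -> exists2 x, (K : set _) x & forall P c,
    (exists N, forall n, (N <= n)%N -> torus_char P (u n) = c) ->
    torus_char P x = c.
Proof.
move=> Ku; have Kc : compact (K : set (torus R)).
  apply: subclosed_compact (@compact_torus R) _ => //.
  exact: closed_subgroup_closed.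
have [|x [Kx xu]] := Kc (u @ \oo) _; first by exists 0%N => // n _; exact: Ku.
exists x => // P c [N uN].
have cc : closed [set c].
  apply: (accessible_finite_set_closed.1 (hausdorff_accessible (@metric_hausdorff _ _))).
  exact: finite_set1.
have clo := (continuous_closedP (@torus_char R P)).1
  (@continuous_torus_char R P) _ cc.
apply: clo => B /xu; apply.
by exists N => // n /= Nn; exact: uN.
Qed.

Theorem theorem4p7 (R : realType) :
  comeager [set K : torus_subgroups R |
    topgroup_isomorphic (subgroup_type K) prod_padics].
Proof.
apply: comeager_generic => K Ktors Kdiv Krank /=.
pose val_ (x : subgroup_type K) : torus R := \val x.
have valK x : (K : set _) (val_ x) by have := valP x; rewrite inE.
have subK x : (K : set _) x -> exists y, val_ y = x.
  by move=> Kx; exists (exist _ x (mem_set Kx)).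
have val_c : continuous val_ by exact: initial_continuous.
(* Polynomials are enumerated by their codes, with 0 for numbers that encode none. *)
apply: (@isomorphic_prod_padics R (subgroup_type K) {poly int}
  (fun P x => torus_char P (val_ x)) (fun n => odflt 0 (unpickle n))).
- by move=> P; exists (pickle P); rewrite pickleK.
- by move=> P Q x; exact: torus_charD.
- by move=> P x y; rewrite -torus_charDr /val_ raddfD.
- move=> P; have [m _ Pm] := Ktors P; exists m.+1 => // x.
  by rewrite -torus_charMnl Pm.
- move=> P m m0; have [Q _ QP] := Kdiv P m m0; exists Q => x.
  by apply/eqP; rewrite -subr_eq0 -torus_charMnl -torus_charBl QP.
- move=> p s p1; have [P _ [Pp Ps]] := Krank p s p1; exists P; split=> [x|Q Qs PQ].
    by rewrite -torus_charMnl Pp.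
  move: Ps; rewrite -bigcap_seq => /(_ Q Qs); apply => x /subK[y <-].
  by rewrite torus_charBl PQ subrr.
- move=> u; have [x /subK[y <-] xP] := cluster_char (fun n => valK (u n)).
  by exists y.
(* The monomials ['X^n] give the coordinates, which separate points and determine the topology. *)
- move=> x y xy; apply: val_inj; apply/funext => n.
  by have := xy 'X^n; rewrite !torus_charXn.
- by move=> P; apply: (continuous_funcomp val_c); exact: continuous_torus_char.
- move=> Y g gc; apply: continuous_comp_initial; apply: continuous_torus => n.
  by have := gc 'X^n; under eq_fun do rewrite torus_charXn.
Qed.
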